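(* Let $G$ be a finite group. Every object of $\mathrm{ALG}^5$ is chain homotopy equivalent to an algebraic $5$-complex in dual form.
   Context: Modules are right $\mathbb{Z}[G]$-modules. The dual of a module $N$ is $N^*=\operatorname{Hom}_{\mathbb{Z}}(N,\mathbb{Z})$ with $(\alpha g)(x)=\alpha(xg^{-1})$; the dual of a map $f$ is precomposition with $f$, denoted $f^*$. The dual of a complex $F_5\to\cdots\to F_0$ is $F_0^*\to F_1^*\to\cdots\to F_5^*$ with dual maps (so $F_i^*$ is in degree $5-i$). $\mathrm{ALG}^5$ is the category whose objects are complexes of finitely generated free $\mathbb{Z}[G]$-modules $F_5\xrightarrow{\partial_5}F_4\xrightarrow{\partial_4}F_3\xrightarrow{\partial_3}F_2\xrightarrow{\partial_2}F_1\xrightarrow{\partial_1}F_0$ satisfying: (i) Poincaré duality: the complex is chain homotopy equivalent to its dual; (ii) exactness at $F_4$ and at $F_1$; (iii) $\operatorname{coker}\partial_1\cong\mathbb{Z}$ and $\ker\partial_5\cong\mathbb{Z}$ (trivial action). Its morphisms are chain homotopy classes of chain maps. Associated $5$-complex: let $F_2\xrightarrow{d_2}F_1\xrightarrow{d_1}F_0$ be a complex of finitely generated free $\mathbb{Z}[G]$-modules, exact at $F_1$, with $\operatorname{coker}d_1\cong\mathbb{Z}$; write $\ker d_2=J^*$ (so $J=(\ker d_2)^*$) and $\iota:J^*\to F_2$ for the inclusion. Let $\beta:J\times J\to\mathbb{Z}$ be a $G$-invariant bilinear form, also regarded as the map $J\to J^*$, $x\mapsto\beta(x,\cdot)$. The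 associated algebraic $5$-complex is $$F_0^*\xrightarrow{d_1^*}F_1^*\xrightarrow{d_2^*}F_2^*\xrightarrow{\iota\beta\iota^*}F_2\xrightarrow{d_2}F_1\xrightarrow{d_1}F_0 .$$ An object of $\mathrm{ALG}^5$ is in dual form if it is the associated $5$-complex of some such pair. *)

(* Defs.v *)
From HB Require Import structures.
From mathcomp Require Import all_boot all_order all_algebra all_fingroup.
From mathcomp Require Import generic_quotient boolp.

Set Implicit Arguments.
Unset Strict Implicit.
Unset Printing Implicit Defensive.

Import GRing.Theory.
Local Open Scope ring_scope.
Local Open Scope quotient_scope.

(* The integral group ring Z[G]: [a g] is the coefficient of [g] in [a]. *)
Definition grpring (G : finGroupType) : Type := {ffun G -> int}.
HB.instance Definition _ (G : finGroupType) := GRing.Zmodule.on (grpring G).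

Section GroupRing.
Variable G : finGroupType.
Implicit Types (a b c : grpring G) (g h k : G).

Definition gelt g : grpring G := [ffun h => (h == g)%:R].

Definition grmul a b : grpring G :=
  [ffun h => \sum_g a g * b (g^-1 * h)%g].

Fact grmulA : associative grmul.
Proof.
move=> a b c; apply/ffunP => h; rewrite !ffunE.
under eq_bigr do rewrite ffunE mulr_sumr.
under [RHS]eq_bigr do rewrite ffunE mulr_suml.
rewrite [RHS]exchange_big /=; apply: eq_bigr => g _.
rewrite [RHS](reindex_inj (mulgI g)) /=; apply: eq_bigr => k _.
by rewrite mulrA mulKg invMg mulgA.
Qed.

Fact grmul1l : left_id (gelt 1%g) grmul.
Proof.
move=> a; apply/ffunP => h; rewrite ffunE (bigD1 1%g) //= big1 => [|g /negPf ng1].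
  by rewrite ffunE eqxx mul1r invg1 mul1g addr0.
by rewrite ffunE ng1 mul0r.
Qed.

Fact grmul1r : right_id (gelt 1%g) grmul.
Proof.
move=> a; apply/ffunP => h; rewrite ffunE (bigD1 h) //= big1 => [|g ngh].
  by rewrite ffunE mulVg eqxx mulr1 addr0.
by rewrite ffunE -eq_mulVg1 (negPf ngh) mulr0.
Qed.

Fact grmulDl : left_distributive grmul +%R.
Proof.
move=> a b c; apply/ffunP => h; rewrite !ffunE -big_split /=.
by apply: eq_bigr => g _; rewrite ffunE mulrDl.
Qed.

Fact grmulDr : right_distributive grmul +%R.
Proof.
move=> a b c; apply/ffunP => h; rewrite !ffunE -big_split /=.
by apply: eq_bigr => g _; rewrite ffunE mulrDr.
Qed.

Fact gr1_neq0 : gelt 1%g != 0.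
Proof. by apply/eqP => /ffunP/(_ 1%g); rewrite !ffunE eqxx. Qed.

HB.instance Definition _ := GRing.Zmodule_isNzRing.Build (grpring G)
  grmulA grmul1l grmul1r grmulDl grmulDr gr1_neq0.

Lemma gelt1 : gelt 1%g = 1.
Proof. by []. Qed.

Lemma grmulE a b h : (a * b) h = \sum_g a g * b (g^-1 * h)%g.
Proof. by rewrite [LHS]ffunE. Qed.

Lemma geltM g h : gelt g * gelt h = gelt (g * h)%g.
Proof.
apply/ffunP => k; rewrite grmulE (bigD1 g) //= big1 => [|i /negPf nig].
  by rewrite !ffunE eqxx mul1r addr0 -(inj_eq (mulgI g)) mulKVg.
by rewrite ffunE nig mul0r.
Qed.

(* The anti-automorphism of Z[G] inverting the elements of G. *)
Definition grinv a : grpring G := [ffun g => a g^-1%g].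

Lemma grinvK : involutive grinv.
Proof. by move=> a; apply/ffunP => g; rewrite !ffunE invgK. Qed.

Lemma grinvD a b : grinv (a + b) = grinv a + grinv b.
Proof. by apply/ffunP => g; rewrite !ffunE. Qed.

Lemma grinvM a b : grinv (a * b) = grinv b * grinv a.
Proof.
apply/ffunP => h; rewrite ffunE !grmulE.
rewrite [RHS](reindex_inj (mulgI h)) /=; apply: eq_bigr => g _.
by rewrite !ffunE mulrC !invMg !invgK mulgA mulVg mul1g.
Qed.

Lemma grinv_gelt g : grinv (gelt g) = gelt g^-1%g.
Proof. by apply/ffunP => h; rewrite !ffunE -(inj_eq invg_inj) invgK. Qed.

Lemma grinv1 : grinv 1 = 1.
Proof. by rewrite -gelt1 grinv_gelt invg1. Qed.

Definition augm a : int := \sum_g a g.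

Lemma augmD a b : augm (a + b) = augm a + augm b.
Proof. by rewrite -big_split /=; apply: eq_bigr => g _; rewrite ffunE. Qed.

Lemma augm_gelt g : augm (gelt g) = 1.
Proof.
rewrite /augm (bigD1 g) //= big1 => [|h /negPf nhg]; last by rewrite ffunE nhg.
by rewrite ffunE eqxx addr0.
Qed.

Lemma augmM a b : augm (a * b) = augm a * augm b.
Proof.
rewrite /augm mulr_suml; under eq_bigr do rewrite grmulE.
rewrite exchange_big; apply: eq_bigr => g _.
by rewrite mulr_sumr (reindex_inj (mulgI g)); apply: eq_bigr => h _; rewrite mulKg.
Qed.

End GroupRing.

(* A right Z[G]-module is a left module over the converse ring: [a *: x] is   *)
(* the product x a, so that [gact x g] is x g and (x g) h = x (g h).          *)
Definition ZGop (G : finGroupType) : nzRingType := (grpring G)^c.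
Notation rmod G := (lmodType (ZGop G)).

Section Modules.
Variable G : finGroupType.
Implicit Types (M N P : rmod G).

Definition gact M (x : M) (g : G) : M := (gelt g : ZGop G) *: x.

Lemma gact1 M (x : M) : gact x 1%g = x.
Proof. exact: scale1r. Qed.

Lemma gactM M (x : M) g h : gact (gact x g) h = gact x (g * h)%g.
Proof. by rewrite /gact scalerA; congr (_ *: _); exact: geltM. Qed.

Definition iso M N : Prop := exists f : {linear M -> N}, bijective f.

Definition fgfree M : Prop := exists n : nat, iso M 'rV[ZGop G]_n.

Definition lin_comp M N P (f : {linear N -> P}) (g : {linear M -> N}) :
  {linear M -> P} := f \o g.

End Modules.

(* Z[G] acts on Z through the augmentation, i.e. G acts trivially. *)
Definition trivZ (G : finGroupType) : Type := int.
HB.instance Definition _ (G : finGroupType) := GRing.Zmodule.on (trivZ G).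

Section TrivZ.
Variable G : finGroupType.

Definition triv_scale (a : ZGop G) (n : trivZ G) : trivZ G :=
  augm a * (n : int).

Fact triv_scaleA a b n :
  triv_scale a (triv_scale b n) = triv_scale (a * b) n.
Proof.
by rewrite /triv_scale mulrA; congr (_ * _); rewrite mulrC -augmM.
Qed.

Fact triv_scale1 : left_id 1 triv_scale.
Proof. by move=> n; rewrite /triv_scale -[1]/(gelt 1%g) augm_gelt mul1r. Qed.

Fact triv_scaleDr : right_distributive triv_scale +%R.
Proof. by move=> a m n; exact: mulrDr. Qed.

Fact triv_scaleDl n : {morph triv_scale^~ n : a b / a + b}.
Proof. by move=> a b; rewrite /triv_scale augmD mulrDl. Qed.

HB.instance Definition _ := GRing.Zmodule_isLmodule.Build (ZGop G) (trivZ G)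
  triv_scaleA triv_scale1 triv_scaleDr triv_scaleDl.

Lemma triv_act (n : trivZ G) g : gact n g = n.
Proof. by rewrite /gact /GRing.scale /= /triv_scale augm_gelt mul1r. Qed.

End TrivZ.

Section Kernel.
Variables (G : finGroupType) (M N : rmod G) (d : {linear M -> N}).

Definition kerp : {pred M} := fun x => d x == 0.

Fact kerp_submod : submod_closed kerp.
Proof.
split=> [|a x y]; rewrite !unfold_in ?linear0 // => /eqP dx /eqP dy.
by rewrite linearP dx dy scaler0 addr0.
Qed.
HB.instance Definition _ :=
  GRing.isSubmodClosed.Build (ZGop G) M kerp kerp_submod.

Definition ker : Type := {x : M | kerp x}.
HB.instance Definition _ := SubChoice.on ker.
HB.instance Definition _ := [SubChoice_isSubLmodule of ker by <:].

Definition ker_incl : {linear ker -> M} := \val.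

Lemma ker_inclP (x : ker) : d (ker_incl x) = 0.
Proof. exact/eqP/(valP x). Qed.

End Kernel.

Section Cokernel.
Variables (G : finGroupType) (M N : rmod G) (d : {linear M -> N}).

Definition coker_rel : rel N := fun x y => `[< exists z, x - y = d z >].

Fact coker_rel_equiv : equiv_class_of coker_rel.
Proof.
split=> [x|x y|y x z].
- by apply/asboolP; exists 0; rewrite linear0 subrr.
- by apply/asboolP/asboolP => -[z e]; exists (- z); rewrite linearN -e opprB.
- move=> /asboolP[u eu] /asboolP[v ev]; apply/asboolP; exists (u + v).
  by rewrite linearD -eu -ev addrA subrK.
Qed.

Canonical coker_equiv := EquivRelPack coker_rel_equiv.
Canonical coker_encModRel := defaultEncModRel coker_rel.

Definition coker : Type := {eq_quot coker_rel}.
HB.instance Definition _ : EqQuotient N coker_rel coker := EqQuotient.on coker.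
HB.instance Definition _ := Choice.on coker.

Lemma coker_eqP (x y : N) : \pi_coker x = \pi_coker y <-> exists z, x - y = d z.
Proof.
by split=> [/eqP|xy]; [|apply/eqP]; rewrite eqmodE => //; [move/asboolP|apply/asboolP].
Qed.

Definition coker_pi (x : N) : coker := \pi_coker x.

Lemma coker_piK (u : coker) : coker_pi (repr u) = u.
Proof. exact: reprK. Qed.

Definition coker_add (u v : coker) := coker_pi (repr u + repr v).
Definition coker_opp (u : coker) := coker_pi (- repr u).
Definition coker_scale (a : ZGop G) (u : coker) := coker_pi (a *: repr u).

Lemma coker_repr (x : N) : exists z, repr (coker_pi x) = x + d z.
Proof.
have /coker_eqP[z e] : coker_pi (repr (coker_pi x)) = coker_pi x.
  exact: coker_piK.
by exists z; rewrite -e addrC subrK.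
Qed.

Lemma coker_piD x y : coker_add (coker_pi x) (coker_pi y) = coker_pi (x + y).
Proof.
rewrite /coker_add; have [u ->] := coker_repr x; have [v ->] := coker_repr y.
by apply/coker_eqP; exists (u + v); rewrite linearD addrACA [LHS]addrC addKr.
Qed.

Lemma coker_piN x : coker_opp (coker_pi x) = coker_pi (- x).
Proof.
rewrite /coker_opp; have [u ->] := coker_repr x; apply/coker_eqP; exists (- u).
by rewrite opprD [LHS]addrC addKr linearN.
Qed.

Lemma coker_piZ a x : coker_scale a (coker_pi x) = coker_pi (a *: x).
Proof.
rewrite /coker_scale; have [u ->] := coker_repr x; apply/coker_eqP; exists (a *: u).
by rewrite scalerDr [LHS]addrC addKr linearZ.
Qed.

Fact coker_addA : associative coker_add.
Proof.
move=> u v w; rewrite -[u]coker_piK -[v]coker_piK -[w]coker_piK.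
by rewrite !coker_piD addrA.
Qed.

Fact coker_addC : commutative coker_add.
Proof. by move=> u v; rewrite /coker_add addrC. Qed.

Fact coker_add0 : left_id (coker_pi 0) coker_add.
Proof. by move=> u; rewrite -[u]coker_piK coker_piD add0r. Qed.

Fact coker_addN : left_inverse (coker_pi 0) coker_opp coker_add.
Proof. by move=> u; rewrite -[u]coker_piK coker_piN coker_piD addNr. Qed.

HB.instance Definition _ := GRing.isZmodule.Build coker
  coker_addA coker_addC coker_add0 coker_addN.

Fact coker_scaleA a b u :
  coker_scale a (coker_scale b u) = coker_scale (a * b) u.
Proof. by rewrite -[u]coker_piK !coker_piZ scalerA. Qed.

Fact coker_scale1 : left_id 1 coker_scale.
Proof. by move=> u; rewrite -[u]coker_piK coker_piZ scale1r. Qed.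

Fact coker_scaleDr : right_distributive coker_scale +%R.
Proof.
move=> a u v; rewrite -[u]coker_piK -[v]coker_piK /GRing.add /=.
by rewrite coker_piD !coker_piZ coker_piD scalerDr.
Qed.

Fact coker_scaleDl u : {morph coker_scale^~ u : a b / a + b}.
Proof.
move=> a b; rewrite -[u]coker_piK [RHS]/GRing.add /=.
by rewrite !coker_piZ coker_piD scalerDl.
Qed.

HB.instance Definition _ := GRing.Zmodule_isLmodule.Build (ZGop G) coker
  coker_scaleA coker_scale1 coker_scaleDr coker_scaleDl.

End Cokernel.

Record dual (G : finGroupType) (N : rmod G) : Type :=
  Dual { dual_fun :> {additive N -> int} }.
HB.instance Definition _ G N := gen_eqMixin (@dual G N).
HB.instance Definition _ G N := gen_choiceMixin (@dual G N).

Section Dual.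
Variables (G : finGroupType) (N : rmod G).
Implicit Types (f g : dual N) (a : ZGop G).

Lemma dualP f g : f =1 g -> f = g.
Proof.
case: f g => [[f [[pf]]]] [[g [[pg]]]] /= e; have {}e : f = g by apply: funext.
by subst g; have -> : pf = pg by exact: Prop_irrelevance.
Qed.

Definition dual_add f g : dual N := Dual (dual_fun f \+ dual_fun g).
Definition dual_opp f : dual N := Dual (\- dual_fun f).
Definition dual_zero : dual N := Dual (\0 : {additive N -> int}).

Fact dual_addA : associative dual_add.
Proof. by move=> f g h; apply: dualP => x; exact: addrA. Qed.
Fact dual_addC : commutative dual_add.
Proof. by move=> f g; apply: dualP => x; exact: addrC. Qed.
Fact dual_add0 : left_id dual_zero dual_add.
Proof. by move=> f; apply: dualP => x; exact: add0r. Qed.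
Fact dual_addN : left_inverse dual_zero dual_opp dual_add.
Proof. by move=> f; apply: dualP => x; exact: addNr. Qed.

HB.instance Definition _ := GRing.isZmodule.Build (dual N)
  dual_addA dual_addC dual_add0 dual_addN.

Definition dual_scale a f : dual N :=
  Dual (dual_fun f \o *:%R (grinv a : ZGop G)).

Fact dual_scaleA a b f : dual_scale a (dual_scale b f) = dual_scale (a * b) f.
Proof.
apply: dualP => x; rewrite /=; congr (_ _).
by rewrite scalerA; congr (_ *: _); rewrite [RHS]grinvM.
Qed.
Fact dual_scale1 : left_id 1 dual_scale.
Proof.
move=> f; apply: dualP => x; rewrite /=; congr (_ _).
by rewrite [X in X *: _]grinv1 scale1r.
Qed.
Fact dual_scaleDr : right_distributive dual_scale +%R.
Proof. by move=> a f g; apply: dualP. Qed.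
Fact dual_scaleDl f : {morph dual_scale^~ f : a b / a + b}.
Proof.
move=> a b; apply: dualP => x; rewrite /=.
by rewrite grinvD scalerDl raddfD.
Qed.

HB.instance Definition _ := GRing.Zmodule_isLmodule.Build (ZGop G) (dual N)
  dual_scaleA dual_scale1 dual_scaleDr dual_scaleDl.

Lemma dual_act f (h : G) (x : N) : (gact f h) x = f (gact x h^-1%g).
Proof. by rewrite /= grinv_gelt. Qed.

Lemma dualDE f g x : (f + g) x = f x + g x. Proof. by []. Qed.
Lemma dualZE a f x : (a *: f) x = f ((grinv a : ZGop G) *: x).
Proof. by []. Qed.
Lemma dual0 f : f 0 = 0. Proof. exact: raddf0. Qed.
Lemma dualD f x y : f (x + y) = f x + f y. Proof. exact: raddfD. Qed.

Definition mk_dual (f : N -> int) (fD : {morph f : x y / x - y}) : dual N :=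
  let m := GRing.isZmodMorphism.Build N int f fD in
  Dual (HB.pack_for {additive N -> int} f m).

Lemma mk_dualE f fD x : @mk_dual f fD x = f x. Proof. by []. Qed.

End Dual.

Section LinInv.
Variables (G : finGroupType) (M N : rmod G) (f : {linear M -> N}).
Hypothesis f_bij : bijective f.

Fact lin_inv_ex : exists g : N -> M, cancel f g /\ cancel g f.
Proof. by case: f_bij => g; exists g. Qed.

Definition lin_inv_fun : N -> M := sval (cid lin_inv_ex).

Lemma lin_invK : cancel f lin_inv_fun.
Proof. exact: (svalP (cid lin_inv_ex)).1. Qed.

Lemma lin_invKV : cancel lin_inv_fun f.
Proof. exact: (svalP (cid lin_inv_ex)).2. Qed.

HB.instance Definition _ :=
  GRing.isLinear.Build (ZGop G) N M *:%R lin_inv_fun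
    (can2_linear lin_invK lin_invKV).

Definition lin_inv : {linear N -> M} := lin_inv_fun.

End LinInv.

Section DualMaps.
Variable G : finGroupType.
Implicit Types M N : rmod G.

Definition dual_map_fun M N (f : {linear M -> N}) (u : dual N) : dual M :=
  Dual (dual_fun u \o f).

Fact dual_map_linear M N (f : {linear M -> N}) : linear (dual_map_fun f).
Proof.
move=> a u v; apply: dualP => x.
rewrite dualDE dualZE -[LHS]/((a *: u + v) (f x)) dualDE dualZE.
by rewrite -linearZ.
Qed.

HB.instance Definition _ M N (f : {linear M -> N}) :=
  GRing.isLinear.Build (ZGop G) (dual N) (dual M) *:%R (dual_map_fun f)
    (dual_map_linear f).

Definition dual_map M N (f : {linear M -> N}) : {linear dual N -> dual M} :=
  dual_map_fun f.

Lemma dual_mapE M N (f : {linear M -> N}) (u : dual N) x :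
  dual_map f u x = u (f x).
Proof. by []. Qed.

(* The canonical evaluation map M -> M^**. *)
Definition ev_fun M (x : M) : dual (dual M) :=
  @mk_dual G (dual M) (fun u : dual M => u x) (fun u v => erefl).

Fact ev_linear M : linear (@ev_fun M).
Proof.
move=> a x y; apply: dualP => u.
rewrite dualDE dualZE -[LHS]/(u (a *: x + y)) dualD; congr (_ + _).
by rewrite -[RHS]/((_ *: u) x) dualZE grinvK.
Qed.

HB.instance Definition _ M :=
  GRing.isLinear.Build (ZGop G) M (dual (dual M)) *:%R (@ev_fun M)
    (@ev_linear M).

Definition ev M : {linear M -> dual (dual M)} := @ev_fun M.

Lemma evE M (x : M) (u : dual M) : ev M x u = u x.
Proof. by []. Qed.

Lemma grp_sum (a : grpring G) : a = \sum_g gelt g *~ a g.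
Proof.
apply/ffunP => h; rewrite sum_ffunE (bigD1 h) //= big1 => [|g /negPf ngh].
  by rewrite addr0 ffunMzE ffunE eqxx intz.
by rewrite ffunMzE ffunE eq_sym ngh mul0rz.
Qed.

Lemma equivariant_scalable M N (f : {additive M -> N}) :
  (forall x g, f (gact x g) = gact (f x) g) -> scalable f.
Proof.
move=> fg a x; rewrite [in LHS](grp_sum a) [in RHS](grp_sum a).
rewrite !scaler_suml raddf_sum; apply: eq_bigr => g _.
by rewrite -!scalerMzl raddfMz; congr (_ *~ _); exact: fg.
Qed.

End DualMaps.

(* The evaluation map is bijective on kernels of maps between finitely        *)
(* generated free modules, which licenses the identification K^** = K.        *)
Section Reflexivity.
Variable G : finGroupType.

Lemma fgfree_coord (M : rmod G) : fgfree M ->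
  exists (m : nat) (c : {additive M -> 'rV[int]_m}), bijective c.
Proof.
move=> [n [f f_bij]]; have [f' fK f'K] := f_bij.
pose T := ('I_n * G)%type; pose m := #|{: T}|.
pose c (x : M) : 'rV[int]_m :=
  \row_k (f x 0 (enum_val k).1 : grpring G) (enum_val k).2.
have cB : {morph c : x y / x - y}.
  by move=> x y; apply/rowP => k; rewrite !mxE linearB !mxE !ffunE.
pose C := HB.pack_for {additive M -> 'rV[int]_m} c
  (GRing.isZmodMorphism.Build M 'rV[int]_m c cB).
exists m, C.
pose c' (v : 'rV[int]_m) : M :=
  f' (\row_i ([ffun g => v 0 (enum_rank ((i, g) : T))] : grpring G)).
exists c' => [x|v].
  rewrite -[RHS]fK; congr f'; apply/rowP => i; rewrite mxE.
  by apply/ffunP => g; rewrite ffunE mxE enum_rankK.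
apply/rowP => k; rewrite mxE f'K mxE ffunE.
by rewrite -surjective_pairing enum_valK.
Qed.

Lemma additive_rV (m k : nat) (f : {additive 'rV[int]_m -> 'rV[int]_k}) v :
  f v = v *m (\matrix_i f (delta_mx 0 i)).
Proof.
rewrite {1}[v]row_sum_delta mulmx_sum_row raddf_sum; apply: eq_bigr => i _.
by rewrite rowK -[v 0 i]intz !scaler_int raddfMz.
Qed.

Lemma kermx_retract (m k : nat) (D : 'M[int]_(m, k)) :
  exists P : 'M[int]_m, P *m D = 0 /\ forall v : 'rV_m, v *m D = 0 -> v *m P = v.
Proof.
have [L uL [R uR [d _ ->]]] := int_Smith_normal_form D.
set S := (\matrix_(i, j) _).
pose Q : 'M[int]_m := \matrix_(i, j) ((i == j) && (row i S == 0))%:R.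
have QS : Q *m S = 0.
  apply/matrixP => i j; rewrite mxE big1 ?mxE // => l _; rewrite mxE.
  case: eqP => [<-|_]; last by rewrite mul0r.
  case: eqP => [/rowP/(_ j)|_]; last by rewrite mul0r.
  by rewrite !mxE => ->; rewrite mulr0.
exists (L *m Q *m invmx L); split.
  by rewrite !mulmxA mulmxKV // -[L *m Q *m S]mulmxA QS mulmx0 mul0mx.
move=> v; rewrite !mulmxA => /(congr1 (mulmxr (invmx R))) /=.
rewrite mulmxK // mul0mx; set w := v *m L => wS.
suff -> : w *m Q = w by rewrite /w mulmxK.
apply/rowP => i; rewrite mxE (bigD1 i) //= big1 => [|l /negPf li]; last first.
  by rewrite [Q _ _]mxE li mulr0.
rewrite addr0 [Q _ _]mxE eqxx /=; case: eqP => [_|/eqP Si]; first by rewrite mulr1.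
rewrite mulr0; have [j Sij] : exists j, S i j != 0.
  apply/existsP; apply: contraNT Si => /existsPn Si; apply/eqP/rowP => j.
  by rewrite !mxE; move/(_ j): Si; rewrite negbK mxE => /eqP.
have ij : i = j :> nat.
  by apply/eqP; move: Sij; apply: contraNT => /negPf nij; rewrite mxE nij.
move/rowP/(_ j): wS; rewrite [LHS]mxE [RHS]mxE (bigD1 i) //= big1 => [|l li].
  by rewrite addr0 => /eqP; rewrite mulf_eq0 (negPf Sij) orbF => /eqP.
have {li}/negPf li : l != i :> nat by apply: contraNneq li => /ord_inj ->.
by rewrite [S _ _]mxE -ij li mulr0n mulr0.
Qed.

Variables (M N : rmod G) (d : {linear M -> N}).
Hypotheses (freeM : fgfree M) (freeN : fgfree N).

Lemma ker_retract : exists p : {additive M -> ker d},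
  forall x, p (ker_incl d x) = x.
Proof.
have [m [c c_bij]] := fgfree_coord freeM; have [c' cK c'K] := c_bij.
have [k [e e_bij]] := fgfree_coord freeN; have e_inj := bij_inj e_bij.
pose C' := HB.pack_for {additive 'rV[int]_m -> M} c'
  (GRing.isZmodMorphism.Build 'rV[int]_m M c' (can2_zmod_morphism cK c'K)).
pose D := \matrix_i (e \o d \o C') (delta_mx 0 i).
have eD v : e (d (c' v)) = v *m D by exact: (additive_rV (e \o d \o C')).
have [P [PD Pid]] := kermx_retract D.
have q0 x : kerp d (c' (c x *m P)).
  by apply/eqP/e_inj; rewrite eD -mulmxA PD mulmx0 raddf0.
pose q x : ker d := exist (fun y => kerp d y) _ (q0 x).
have qB : {morph q : x y / x - y}.
  move=> x y; apply: val_inj.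
  by rewrite raddfB /= raddfB mulmxBl; exact: (raddfB C').
exists (HB.pack_for {additive M -> ker d} q
  (GRing.isZmodMorphism.Build M (ker d) q qB)).
move=> x; apply: val_inj => /=; rewrite Pid ?cK // -eD cK.
by rewrite ker_inclP raddf0.
Qed.

Lemma additive_int_rV (m : nat) (f : {additive 'rV[int]_m -> int}) v :
  f v = \sum_i v 0 i * f (delta_mx 0 i).
Proof.
rewrite {1}[v]row_sum_delta raddf_sum; apply: eq_bigr => i _.
by rewrite -{1}[v 0 i]intz scaler_int raddfMz -mulrzl intz.
Qed.

Lemma ev_ker_bij : bijective (ev (ker d)).
Proof.
have [m [c c_bij]] := fgfree_coord freeM; have [c' cK c'K] := c_bij.
pose C' := HB.pack_for {additive 'rV[int]_m -> M} c'
  (GRing.isZmodMorphism.Build 'rV[int]_m M c' (can2_zmod_morphism cK c'K)).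
have [p pK] := ker_retract.
have coordB i : {morph (fun x => c x 0 i) : x y / x - y}.
  by move=> x y; rewrite raddfB !mxE.
pose coord i : dual M := mk_dual (coordB i).
have inj : injective (ev (ker d)).
  move=> x y exy; apply: val_inj; apply: (bij_inj c_bij); apply/rowP => i.
  pose at_i (u : dual (dual (ker d))) := u (dual_map (ker_incl d) (coord i)).
  exact: (congr1 at_i exy).
have surj (phi : dual (dual (ker d))) : exists x, ev (ker d) x = phi.
  pose r i := phi (dual_map (ker_incl d) (coord i)).
  pose x := c' (\row_i r i).
  have aE (a : dual M) y : a y = \sum_i c y 0 i * a (c' (delta_mx 0 i)).
    rewrite -{1}[y]cK.
    exact: (additive_int_rV (dual_fun a \o C' : {additive _ -> int})).
  have xE (a : dual M) : a x = phi (dual_map (ker_incl d) a).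
    have aS : a = \sum_i coord i *~ a (c' (delta_mx 0 i)).
      apply: dualP => y.
      rewrite -[RHS](evE y) raddf_sum aE; apply: eq_bigr => i _.
      by rewrite raddfMz evE -mulrzr intz.
    rewrite aE /x c'K {2}aS !raddf_sum; apply: eq_bigr => i _.
    by rewrite mxE !raddfMz -mulrzr intz.
  exists (p x); apply: dualP => b; rewrite evE.
  have bpB : {morph (fun y => b (p y)) : y z / y - z}.
    by move=> y z; rewrite !raddfB.
  rewrite -[LHS]/(mk_dual bpB x) xE; congr (phi _); apply: dualP => z.
  by rewrite -[LHS]/(b (p (ker_incl d z))) pK.
have [g gP] := choice surj.
by exists g => // y; apply: inj.
Qed.

End Reflexivity.

(* The inclusion (ker d)^** -> M, through the identification (ker d)^** =     *)
(* ker d given by evaluation.                                                 *)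
Section BidualInclusion.
Variables (G : finGroupType) (M N : rmod G) (d : {linear M -> N}).
Variables (freeM : fgfree M) (freeN : fgfree N).

Definition bidual_incl : {linear dual (dual (ker d)) -> M} :=
  lin_comp (ker_incl d) (lin_inv (ev_ker_bij d freeM freeN)).

Lemma bidual_incl_ev x : bidual_incl (ev (ker d) x) = ker_incl d x.
Proof. by rewrite /bidual_incl /= lin_invK. Qed.

Lemma bidual_inclP x : d (bidual_incl x) = 0.
Proof. exact: ker_inclP. Qed.

End BidualInclusion.

Record invform (G : finGroupType) (J : rmod G) := InvForm {
  form_fun :> J -> J -> int;
  form_Dl : forall x y z, form_fun (x + y) z = form_fun x z + form_fun y z;
  form_Dr : forall x y z, form_fun x (y + z) = form_fun x y + form_fun x z;
  form_inv : forall x y g, form_fun (gact x g) (gact y g) = form_fun x y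
}.

Section FormMap.
Variables (G : finGroupType) (J : rmod G) (b : invform J).

Fact form_mapB x : {morph b x : y z / y - z}.
Proof.
by move=> y z; apply: (addIr (b x z)); rewrite -form_Dr !subrK.
Qed.

Definition form_map_fun (x : J) : dual J := mk_dual (form_mapB x).

Fact form_map_zmod : zmod_morphism form_map_fun.
Proof.
move=> x y; apply: dualP => z; apply: (addIr (b y z)).
by rewrite -form_Dl subrK -[RHS]/(b x z - b y z + b y z) subrK.
Qed.
HB.instance Definition _ :=
  GRing.isZmodMorphism.Build J (dual J) form_map_fun form_map_zmod.

Fact form_map_scalable : scalable form_map_fun.
Proof.
apply: equivariant_scalable => x g; apply: dualP => y.
rewrite dual_act -[LHS]/(b (gact x g) y) -[RHS]/(b x (gact y g^-1%g)).
by rewrite -[RHS](form_inv b _ _ g) gactM mulVg gact1.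
Qed.
HB.instance Definition _ :=
  GRing.isScalable.Build (ZGop G) J (dual J) *:%R form_map_fun form_map_scalable.

Definition form_map : {linear J -> dual J} := form_map_fun.

Lemma form_mapE x y : form_map x y = b x y.
Proof. by []. Qed.

End FormMap.

Definition exact (G : finGroupType) (M N P : rmod G)
    (f : {linear M -> N}) (g : {linear N -> P}) : Prop :=
  forall y : N, g y = 0 <-> exists x : M, f x = y.

Record complex5 (G : finGroupType) := Complex5 {
  cx5 : rmod G; cx4 : rmod G; cx3 : rmod G;
  cx2 : rmod G; cx1 : rmod G; cx0 : rmod G;
  bd5 : {linear cx5 -> cx4};
  bd4 : {linear cx4 -> cx3};
  bd3 : {linear cx3 -> cx2};
  bd2 : {linear cx2 -> cx1};
  bd1 : {linear cx1 -> cx0};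
  bd45 : forall x, bd4 (bd5 x) = 0;
  bd34 : forall x, bd3 (bd4 x) = 0;
  bd23 : forall x, bd2 (bd3 x) = 0;
  bd12 : forall x, bd1 (bd2 x) = 0
}.

Section Complexes.
Variable G : finGroupType.
Implicit Types C D E : complex5 G.

Fact dual_bd (M N P : rmod G) (f : {linear M -> N}) (g : {linear N -> P}) :
  (forall x, g (f x) = 0) -> forall u, dual_map f (dual_map g u) = 0.
Proof. by move=> gf u; apply: dualP => x; rewrite !dual_mapE gf dual0. Qed.

Definition dual_complex C : complex5 G :=
  @Complex5 G (dual (cx0 C)) (dual (cx1 C)) (dual (cx2 C))
    (dual (cx3 C)) (dual (cx4 C)) (dual (cx5 C))
    (dual_map (bd1 C)) (dual_map (bd2 C)) (dual_map (bd3 C))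
    (dual_map (bd4 C)) (dual_map (bd5 C))
    (dual_bd (@bd12 G C)) (dual_bd (@bd23 G C))
    (dual_bd (@bd34 G C)) (dual_bd (@bd45 G C)).

Record chain_map C D := ChainMap {
  cm5 : {linear cx5 C -> cx5 D};
  cm4 : {linear cx4 C -> cx4 D};
  cm3 : {linear cx3 C -> cx3 D};
  cm2 : {linear cx2 C -> cx2 D};
  cm1 : {linear cx1 C -> cx1 D};
  cm0 : {linear cx0 C -> cx0 D};
  cm_bd5 : forall x, cm4 (bd5 C x) = bd5 D (cm5 x);
  cm_bd4 : forall x, cm3 (bd4 C x) = bd4 D (cm4 x);
  cm_bd3 : forall x, cm2 (bd3 C x) = bd3 D (cm3 x);
  cm_bd2 : forall x, cm1 (bd2 C x) = bd2 D (cm2 x);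
  cm_bd1 : forall x, cm0 (bd1 C x) = bd1 D (cm1 x)
}.

Definition cm_id C : chain_map C C :=
  @ChainMap C C idfun idfun idfun idfun idfun idfun
    (fun _ => erefl) (fun _ => erefl) (fun _ => erefl)
    (fun _ => erefl) (fun _ => erefl).

Fact cm_comp_bd (M N M' N' M'' N'' : rmod G) (d : {linear M -> N})
    (d' : {linear M' -> N'}) (d'' : {linear M'' -> N''})
    (f : {linear M -> M'}) (f0 : {linear N -> N'})
    (g : {linear M' -> M''}) (g0 : {linear N' -> N''}) :
  (forall x, g0 (d' x) = d'' (g x)) -> (forall x, f0 (d x) = d' (f x)) ->
  forall x, lin_comp g0 f0 (d x) = d'' (lin_comp g f x).
Proof. by move=> gd fd x; rewrite /= fd gd. Qed.

Definition cm_comp C D E (g : chain_map D E) (f : chain_map C D) :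
    chain_map C E :=
  @ChainMap C E (lin_comp (cm5 g) (cm5 f)) (lin_comp (cm4 g) (cm4 f))
    (lin_comp (cm3 g) (cm3 f)) (lin_comp (cm2 g) (cm2 f))
    (lin_comp (cm1 g) (cm1 f)) (lin_comp (cm0 g) (cm0 f))
    (cm_comp_bd (cm_bd5 g) (cm_bd5 f)) (cm_comp_bd (cm_bd4 g) (cm_bd4 f))
    (cm_comp_bd (cm_bd3 g) (cm_bd3 f)) (cm_comp_bd (cm_bd2 g) (cm_bd2 f))
    (cm_comp_bd (cm_bd1 g) (cm_bd1 f)).

Record chain_homotopy C D (f g : chain_map C D) := ChainHomotopy {
  ch0 : {linear cx0 C -> cx1 D};
  ch1 : {linear cx1 C -> cx2 D};
  ch2 : {linear cx2 C -> cx3 D};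
  ch3 : {linear cx3 C -> cx4 D};
  ch4 : {linear cx4 C -> cx5 D};
  ch_0 : forall x, cm0 f x - cm0 g x = bd1 D (ch0 x);
  ch_1 : forall x, cm1 f x - cm1 g x = bd2 D (ch1 x) + ch0 (bd1 C x);
  ch_2 : forall x, cm2 f x - cm2 g x = bd3 D (ch2 x) + ch1 (bd2 C x);
  ch_3 : forall x, cm3 f x - cm3 g x = bd4 D (ch3 x) + ch2 (bd3 C x);
  ch_4 : forall x, cm4 f x - cm4 g x = bd5 D (ch4 x) + ch3 (bd4 C x);
  ch_5 : forall x, cm5 f x - cm5 g x = ch4 (bd5 C x)
}.

Definition homotopic C D (f g : chain_map C D) : Prop :=
  inhabited (chain_homotopy f g).

Definition chain_equiv C D : Prop :=
  exists (f : chain_map C D) (g : chain_map D C),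
    homotopic (cm_comp g f) (cm_id C) /\ homotopic (cm_comp f g) (cm_id D).

End Complexes.

Record ALG5 (G : finGroupType) := Alg5 {
  alg_cx :> complex5 G;
  alg_free5 : fgfree (cx5 alg_cx);
  alg_free4 : fgfree (cx4 alg_cx);
  alg_free3 : fgfree (cx3 alg_cx);
  alg_free2 : fgfree (cx2 alg_cx);
  alg_free1 : fgfree (cx1 alg_cx);
  alg_free0 : fgfree (cx0 alg_cx);
  alg_duality : chain_equiv alg_cx (dual_complex alg_cx);
  alg_exact4 : exact (bd5 alg_cx) (bd4 alg_cx);
  alg_exact1 : exact (bd2 alg_cx) (bd1 alg_cx);
  alg_coker : iso (coker (bd1 alg_cx)) (trivZ G);
  alg_ker : iso (ker (bd5 alg_cx)) (trivZ G)
}.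

Record half_complex (G : finGroupType) := HalfComplex {
  hc2 : rmod G; hc1 : rmod G; hc0 : rmod G;
  hd2 : {linear hc2 -> hc1};
  hd1 : {linear hc1 -> hc0};
  hd12 : forall x, hd1 (hd2 x) = 0;
  hc_free2 : fgfree hc2;
  hc_free1 : fgfree hc1;
  hc_free0 : fgfree hc0;
  hc_exact1 : exact hd2 hd1;
  hc_coker : iso (coker hd1) (trivZ G)
}.

Section Associated.
Variables (G : finGroupType) (F : half_complex G).

Definition hcJ : rmod G := dual (ker (hd2 F)).

Definition iota : {linear dual hcJ -> hc2 F} :=
  bidual_incl (hd2 F) (hc_free2 F) (hc_free1 F).

(* iota^*, read as a map F_2^* -> J: restriction of functionals to ker d_2. *)
Definition iota_dual : {linear dual (hc2 F) -> hcJ} :=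
  dual_map (ker_incl (hd2 F)).

Lemma iota_dualE u : ev hcJ (iota_dual u) = dual_map iota u.
Proof.
apply: dualP => x; have [k <-] : exists k, ev (ker (hd2 F)) k = x.
  by have [g _ gK] := ev_ker_bij (hd2 F) (hc_free2 F) (hc_free1 F); exists (g x).
by rewrite dual_mapE bidual_incl_ev.
Qed.

Variable b : invform hcJ.

Definition mid_map : {linear dual (hc2 F) -> hc2 F} :=
  lin_comp iota (lin_comp (form_map b) iota_dual).

Fact mid_map_l u : mid_map (dual_map (hd2 F) u) = 0.
Proof.
rewrite /mid_map /= (_ : dual_map _ _ = 0) ?linear0 //.
exact: (dual_bd (@ker_inclP _ _ _ (hd2 F))).
Qed.

Fact mid_map_r u : hd2 F (mid_map u) = 0.
Proof. exact: bidual_inclP. Qed.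

Definition associated : complex5 G :=
  @Complex5 G (dual (hc0 F)) (dual (hc1 F)) (dual (hc2 F)) (hc2 F) (hc1 F) (hc0 F)
    (dual_map (hd1 F)) (dual_map (hd2 F)) mid_map (hd2 F) (hd1 F)
    (dual_bd (@hd12 G F)) mid_map_l mid_map_r (@hd12 G F).

End Associated.

Definition in_dual_form (G : finGroupType) (D : ALG5 G) : Prop :=
  exists (F : half_complex G) (b : invform (hcJ F)), alg_cx D = associated b.

(* Main.v *)
From HB Require Import structures.
From mathcomp Require Import all_boot all_order all_algebra all_fingroup.
From mathcomp Require Import boolp generic_quotient zify.
Require Import Defs.

Set Implicit Arguments.
Unset Strict Implicit.
Unset Printing Implicit Defensive.

Import GRing.Theory.
Local Open Scope ring_scope.

(** Write the given complex as an upper half F5 -> F4 -> F3 glued by d3 to a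
    lower half A, which is F2 -> F1 -> F0, and let B, which is F3^* -> F4^* -> F5^*,
    be the dual of the upper half.  A complex is in dual form as soon as its upper half
    is the dual of its lower half: its middle map kills the image of d2^* and
    lands in ker d2, and since kernels of maps between free modules are direct
    summands over Z, the functionals vanishing on ker d2 are exactly those in
    the image of d2^*; hence the middle map factors as iota b iota^*
    ([mid_map_onto], [dual_form_equiv]).  So the task is to replace A by B, up
    to adding free modules in degrees 3 and 2.

    Poincare duality makes B exact in the middle, because A is, and identifies
    the cokernels of A and B.  Thus A and B are the beginnings of two free
    resolutions of the same module Z, and Schanuel's lemma, applied three times
    ([schanuel], [schanuel_step]), turns A into B after elementary complexes
    P = P have been added in degrees (1,0), (2,1) and (3,2).  Adding such
    complexes does not change the chain homotopy type, and those in degrees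
    (1,0) and (2,1) on the side of B can be cancelled again, so that the given
    complex is equivalent to
      F5 -> F4 -> F3 + Y2 -> B2 + X2 -> B1 -> B0
    for the free modules Y2 = B2 + A1 + B0 and X2 = A2 + B1 + A0, where Ai = Fi and
    Bi is the dual of F(5-i)
    ([replace_lower]).

    For the upper half to be the dual of the lower one, Y2 and the dual of X2
    must be isomorphic, that is, Y2 and X2 must have the same rank.  This says
    that the Euler characteristic of the complex is zero, which again follows
    from duality: the Euler characteristic is a homotopy invariant
    ([euler_char_equiv]), and passing to the dual changes its sign because the
    length of the complex is odd.

    Finally the resulting complex in dual form satisfies the axioms because
    duality, exactness and the end homology groups are homotopy invariant. *)

(** * Linear maps *)

Section LinearMaps.
Variable G : finGroupType.
Implicit Types M N P Q : rmod G.

Definition mklin M N (f : M -> N) (fL : linear f) : {linear M -> N} :=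
  let m := GRing.isLinear.Build (ZGop G) M N *:%R f fL in
  HB.pack_for {linear M -> N} f m.

Definition lzero M N : {linear M -> N} := (\0 : {linear M -> N}).

Fact lpair_linear M N P (f : {linear M -> N}) (g : {linear M -> P}) :
  linear (fun x => (f x, g x)).
Proof. by move=> a x y; rewrite !linearP. Qed.

Definition lpair M N P (f : {linear M -> N}) (g : {linear M -> P}) :
  {linear M -> (N * P)%type} := mklin (lpair_linear f g).

Definition lfst M N : {linear (M * N)%type -> M} := fst.
Definition lsnd M N : {linear (M * N)%type -> N} := snd.
Definition linl M N : {linear M -> (M * N)%type} := lpair idfun (lzero M N).
Definition linr M N : {linear N -> (M * N)%type} := lpair (lzero N M) idfun.
Definition lprod M N M' N' (f : {linear M -> M'}) (g : {linear N -> N'}) :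
    {linear (M * N)%type -> (M' * N')%type} :=
  lpair (lin_comp f (lfst M N)) (lin_comp g (lsnd M N)).
Definition lsub M N (f g : {linear M -> N}) : {linear M -> N} := f \- g.
Definition ladd M N (f g : {linear M -> N}) : {linear M -> N} := f \+ g.

Lemma iso_sym M N : iso M N -> iso N M.
Proof.
move=> [f fb]; exists (lin_inv fb).
by exists f; [exact: lin_invKV | exact: lin_invK].
Qed.

Lemma iso_trans M N P : iso M N -> iso N P -> iso M P.
Proof.
by move=> [f fb] [g gb]; exists (lin_comp g f); exact: bij_comp.
Qed.

Lemma lprod_bij M N M' N' (f : {linear M -> M'}) (g : {linear N -> N'}) :
  bijective f -> bijective g -> bijective (lprod f g).
Proof.
move=> [f' fK f'K] [g' gK g'K].
by exists (fun z => (f' z.1, g' z.2)) => -[x y]; rewrite /= ?(fK, gK, f'K, g'K).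
Qed.

Lemma iso_prod M N M' N' :
  iso M M' -> iso N N' -> iso (M * N)%type (M' * N')%type.
Proof. by move=> [f fb] [g gb]; exists (lprod f g); exact: lprod_bij. Qed.

Lemma lin_factor M Q P (q : {linear M -> Q}) (f : {linear M -> P}) :
    (forall y, exists x, q x = y) -> (forall x, q x = 0 -> f x = 0) ->
  exists h : {linear Q -> P}, forall x, h (q x) = f x.
Proof.
move=> /choice[s sK] fq.
have fs x y : q x = q y -> f x = f y.
  move=> e; apply/eqP; rewrite -subr_eq0 -linearB; apply/eqP/fq.
  by rewrite linearB e subrr.
have hL : linear (fun y => f (s y)).
  by move=> a y z; rewrite -linearP; apply: fs; rewrite linearP !sK.
by exists (mklin hL) => x; apply: fs; rewrite sK.
Qed.

Lemma ker_factor M N P (d : {linear N -> P}) (f : {linear M -> N}) :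
    (forall x, d (f x) = 0) ->
  exists h : {linear M -> ker d}, forall x, ker_incl d (h x) = f x.
Proof.
move=> df; pose h x : ker d := exist (fun y => kerp d y) (f x) (introT eqP (df x)).
have hL : linear h by move=> a x y; apply: val_inj; rewrite /= linearP.
by exists (mklin hL).
Qed.

End LinearMaps.

(** * Chain homotopy equivalences *)

Section ChainEquiv.
Variable G : finGroupType.
Implicit Types C D E : complex5 G.

Lemma chain_equiv_sym C D : chain_equiv C D -> chain_equiv D C.
Proof. by move=> [f [g [gf fg]]]; exists g, f. Qed.

(** A homotopy g' f' ~ 1 is transported along f and g to a homotopy
    g g' f' f ~ g f, to which the homotopy g f ~ 1 is added. *)
Lemma homotopic_conj C D E (g : chain_map D C) (f : chain_map C D)
    (g' : chain_map E D) (f' : chain_map D E) :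
  homotopic (cm_comp g f) (cm_id C) -> homotopic (cm_comp g' f') (cm_id D) ->
  homotopic (cm_comp (cm_comp g g') (cm_comp f' f)) (cm_id C).
Proof.
move=> [h] [k]; split.
apply: (@ChainHomotopy G C C _ _
  (ladd (ch0 h) (lin_comp (cm1 g) (lin_comp (ch0 k) (cm0 f))))
  (ladd (ch1 h) (lin_comp (cm2 g) (lin_comp (ch1 k) (cm1 f))))
  (ladd (ch2 h) (lin_comp (cm3 g) (lin_comp (ch2 k) (cm2 f))))
  (ladd (ch3 h) (lin_comp (cm4 g) (lin_comp (ch3 k) (cm3 f))))
  (ladd (ch4 h) (lin_comp (cm5 g) (lin_comp (ch4 k) (cm4 f))))) => x /=.
- move: (ch_0 h x) (ch_0 k (cm0 f x)) => /=.
  move=> hx /eqP; rewrite subr_eq => /eqP->.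
  by rewrite !linearD /= cm_bd1 -hx [in RHS]addrC addrA.
- move: (ch_1 h x) (ch_1 k (cm1 f x)) => /=.
  move=> hx /eqP; rewrite subr_eq => /eqP->.
  rewrite !linearD /= cm_bd2 -cm_bd1 addrACA -hx.
  by rewrite [in RHS]addrC addrA.
- move: (ch_2 h x) (ch_2 k (cm2 f x)) => /=.
  move=> hx /eqP; rewrite subr_eq => /eqP->.
  rewrite !linearD /= cm_bd3 -cm_bd2 addrACA -hx.
  by rewrite [in RHS]addrC addrA.
- move: (ch_3 h x) (ch_3 k (cm3 f x)) => /=.
  move=> hx /eqP; rewrite subr_eq => /eqP->.
  rewrite !linearD /= cm_bd4 -cm_bd3 addrACA -hx.
  by rewrite [in RHS]addrC addrA.
- move: (ch_4 h x) (ch_4 k (cm4 f x)) => /=.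
  move=> hx /eqP; rewrite subr_eq => /eqP->.
  rewrite !linearD /= cm_bd5 -cm_bd4 addrACA -hx.
  by rewrite [in RHS]addrC addrA.
- move: (ch_5 h x) (ch_5 k (cm5 f x)) => /=.
  move=> hx /eqP; rewrite subr_eq => /eqP->.
  by rewrite !linearD /= -cm_bd5 -hx [in RHS]addrC addrA.
Qed.

Lemma chain_equiv_trans C D E :
  chain_equiv C D -> chain_equiv D E -> chain_equiv C E.
Proof.
move=> [f [g [gf fg]]] [f' [g' [gf' fg']]].
by exists (cm_comp f' f), (cm_comp g g'); split; exact: homotopic_conj.
Qed.

Lemma homotopic_idP C (f : chain_map C C) :
    cm5 f =1 id -> cm4 f =1 id -> cm3 f =1 id -> cm2 f =1 id ->
    cm1 f =1 id -> cm0 f =1 id ->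
  homotopic f (cm_id C).
Proof.
move=> e5 e4 e3 e2 e1 e0; split.
by apply: (@ChainHomotopy G C C _ _ (lzero _ _) (lzero _ _) (lzero _ _)
  (lzero _ _) (lzero _ _)) => x /=;
  rewrite ?(e5, e4, e3, e2, e1, e0) subrr ?linear0 ?addr0.
Qed.

Lemma inv_comm (M N M' N' : rmod G) (d : {linear M -> N})
    (d' : {linear M' -> N'}) (f : {linear M -> M'}) (h : {linear N -> N'})
    (fb : bijective f) (hb : bijective h) :
  (forall x, h (d x) = d' (f x)) ->
  forall y, lin_inv hb (d' y) = d (lin_inv fb y).
Proof.
move=> e y; apply: (bij_inj hb).
by rewrite e /= !lin_invKV.
Qed.

Lemma chain_iso_equiv C D (f : chain_map C D) :
    bijective (cm5 f) -> bijective (cm4 f) -> bijective (cm3 f) ->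
    bijective (cm2 f) -> bijective (cm1 f) -> bijective (cm0 f) ->
  chain_equiv C D.
Proof.
move=> b5 b4 b3 b2 b1 b0.
exists f, (@ChainMap G D C (lin_inv b5) (lin_inv b4) (lin_inv b3) (lin_inv b2)
  (lin_inv b1) (lin_inv b0) (inv_comm _ _ (cm_bd5 f)) (inv_comm _ _ (cm_bd4 f))
  (inv_comm _ _ (cm_bd3 f)) (inv_comm _ _ (cm_bd2 f)) (inv_comm _ _ (cm_bd1 f))).
by split; apply: homotopic_idP => x /=; rewrite ?lin_invK ?lin_invKV.
Qed.

Definition dual_cm C D (f : chain_map C D) :
    chain_map (dual_complex D) (dual_complex C).
Proof.
refine (@ChainMap G (dual_complex D) (dual_complex C)
  (dual_map (cm0 f)) (dual_map (cm1 f)) (dual_map (cm2 f))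
  (dual_map (cm3 f)) (dual_map (cm4 f)) (dual_map (cm5 f)) _ _ _ _ _);
move=> u; apply: dualP => x; congr (dual_fun u _).
- exact/esym/cm_bd1.
- exact/esym/cm_bd2.
- exact/esym/cm_bd3.
- exact/esym/cm_bd4.
- exact/esym/cm_bd5.
Defined.

Lemma dualB (M : rmod G) (u : dual M) x y : u x - u y = u (x - y).
Proof. by rewrite raddfB. Qed.

(** Dualizing reverses the degrees, so the homotopy from degree i to i + 1 of the
    dual is the dual of the one from degree 4 - i to 5 - i. *)
Lemma homotopic_dual C D (f : chain_map C D) (g : chain_map D C) :
  homotopic (cm_comp g f) (cm_id C) ->
  homotopic (cm_comp (dual_cm f) (dual_cm g)) (cm_id (dual_complex C)).
Proof.
move=> [h]; split.
apply: (@ChainHomotopy G (dual_complex C) (dual_complex C) _ _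
  (dual_map (ch4 h)) (dual_map (ch3 h)) (dual_map (ch2 h))
  (dual_map (ch1 h)) (dual_map (ch0 h))) => u; apply: dualP => x.
- by rewrite -[LHS]/(u (cm5 (cm_comp g f) x) - u x) dualB (ch_5 h).
- by rewrite -[LHS]/(u (cm4 (cm_comp g f) x) - u x) dualB (ch_4 h) addrC dualD.
- by rewrite -[LHS]/(u (cm3 (cm_comp g f) x) - u x) dualB (ch_3 h) addrC dualD.
- by rewrite -[LHS]/(u (cm2 (cm_comp g f) x) - u x) dualB (ch_2 h) addrC dualD.
- by rewrite -[LHS]/(u (cm1 (cm_comp g f) x) - u x) dualB (ch_1 h) addrC dualD.
- by rewrite -[LHS]/(u (cm0 (cm_comp g f) x) - u x) dualB (ch_0 h).
Qed.

Lemma chain_equiv_dual C D :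
  chain_equiv C D -> chain_equiv (dual_complex C) (dual_complex D).
Proof.
move=> [f [g [gf fg]]]; exists (dual_cm g), (dual_cm f).
by split; apply: homotopic_dual.
Qed.

End ChainEquiv.

(** * Adding elementary complexes *)

Section Expansion.
Variables (G : finGroupType) (C : complex5 G).

Section Low.
Variables P Q : rmod G.

(** The direct sum of C with P = P in degrees 1, 0 and Q = Q in degrees 2, 1. *)
Definition expand_low : complex5 G.
Proof.
refine (@Complex5 G (cx5 C) (cx4 C) (cx3 C) (cx2 C * Q)%type
  ((cx1 C * P) * Q)%type (cx0 C * P)%type (bd5 C) (bd4 C)
  (lin_comp (linl _ Q) (bd3 C)) (lprod (lin_comp (linl _ P) (bd2 C)) idfun)
  (lin_comp (lprod (bd1 C) idfun) (lfst _ Q)) (@bd45 G C) _ _ _) => x /=.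
- by rewrite bd34.
- by rewrite bd23.
- by rewrite bd12.
Defined.

Lemma expand_low_equiv : chain_equiv C expand_low.
Proof.
unshelve eexists.
  by apply: (@ChainMap G C expand_low idfun idfun idfun (linl _ _)
    (lin_comp (linl _ _) (linl _ _)) (linl _ _)).
unshelve eexists.
  by apply: (@ChainMap G expand_low C idfun idfun idfun (lfst _ _)
    (lin_comp (lfst _ _) (lfst _ _)) (lfst _ _)).
split; first exact: homotopic_idP.
(* Projecting to C and including back, minus 1, is minus the projection onto
   P = P and Q = Q, which is contracted by minus the inverses of these
   identities. *)
split; apply: (@ChainHomotopy G expand_low expand_low _ _
  (lsub (lzero _ _) (lin_comp (linl _ _) (lin_comp (linr _ _) (lsnd _ _))))
  (lsub (lzero _ _) (lin_comp (linr _ _) (lsnd _ _)))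
  (lzero _ _) (lzero _ _) (lzero _ _)) => /=.
- by move=> [x p] /=; rewrite /= subr0 linear0; congr pair; rewrite subrr.
- move=> [[x p] q] /=.
  by congr (_, _, _); rewrite /= !(subrr, sub0r, subr0, oppr0, add0r, addr0) ?linear0.
- move=> [x q] /=.
  by congr (_, _); rewrite /= !(subrr, sub0r, subr0, oppr0, add0r, addr0) ?linear0.
- by move=> x; rewrite subrr linear0 addr0.
- by move=> x; rewrite subrr linear0 addr0.
- by move=> x; rewrite subrr.
Qed.

End Low.

Variable R : rmod G.

(** The direct sum of C with R = R in degrees 3, 2. *)
Definition expand_mid : complex5 G.
Proof.
refine (@Complex5 G (cx5 C) (cx4 C) (cx3 C * R)%type (cx2 C * R)%type
  (cx1 C) (cx0 C) (bd5 C) (lin_comp (linl _ R) (bd4 C))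
  (lprod (bd3 C) idfun) (lin_comp (bd2 C) (lfst _ R)) (bd1 C) _ _ _ _) => x /=.
- by rewrite bd45.
- by rewrite bd34.
- by rewrite bd23.
- by rewrite bd12.
Defined.

Lemma expand_mid_equiv : chain_equiv C expand_mid.
Proof.
unshelve eexists.
  by apply: (@ChainMap G C expand_mid idfun idfun (linl _ _) (linl _ _)
    idfun idfun).
unshelve eexists.
  by apply: (@ChainMap G expand_mid C idfun idfun (lfst _ _) (lfst _ _)
    idfun idfun).
split; first exact: homotopic_idP.
split; apply: (@ChainHomotopy G expand_mid expand_mid _ _
  (lzero _ _) (lzero _ _)
  (lsub (lzero _ _) (lin_comp (linr _ _) (lsnd _ _)))
  (lzero _ _) (lzero _ _)) => /=.
- by move=> x; rewrite subrr linear0.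
- by move=> x; rewrite subrr linear0 addr0.
- move=> [x q] /=.
  by congr (_, _); rewrite /= !(subrr, sub0r, subr0, oppr0, add0r, addr0) ?linear0.
- move=> [x q] /=.
  by congr (_, _); rewrite /= !(subrr, sub0r, subr0, oppr0, add0r, addr0) ?linear0.
- by move=> x; rewrite subrr linear0 addr0.
- by move=> x; rewrite subrr.
Qed.

End Expansion.

(** * Free modules and their duals *)

Section Free.
Variable G : finGroupType.
Implicit Types M N : rmod G.

Definition free_of_rank M (n : nat) : Prop := iso M 'rV[ZGop G]_n.

Lemma free_of_rank_prod M N m n :
  free_of_rank M m -> free_of_rank N n -> free_of_rank (M * N)%type (m + n).
Proof.
move=> isoM isoN; apply: iso_trans (iso_prod isoM isoN) _.
have rL : linear (fun z : 'rV[ZGop G]_m * 'rV[ZGop G]_n => row_mx z.1 z.2).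
  by move=> a x y; rewrite /= -add_row_mx -scale_row_mx.
exists (mklin rL); exists (fun v => (lsubmx v, rsubmx v)) => [[x y]|v] /=.
  by rewrite row_mxKl row_mxKr.
by rewrite hsubmxK.
Qed.

Lemma fgfree_prod M N : fgfree M -> fgfree N -> fgfree (M * N)%type.
Proof. by move=> [m fM] [n fN]; exists (m + n)%N; exact: free_of_rank_prod. Qed.

Lemma iso_dual M N : iso M N -> iso (dual N) (dual M).
Proof.
move=> [f fb]; exists (dual_map f); exists (dual_map (lin_inv fb)) => u.
  by apply: dualP => x; rewrite !dual_mapE /= lin_invKV.
by apply: dualP => x; rewrite !dual_mapE /= lin_invK.
Qed.

(** The ring [ZGop G] hides the underlying function; this exposes it. *)
Definition coef (a : ZGop G) (g : G) : int := (a : grpring G) g.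

Lemma coefB a b g : coef (a - b) g = coef a g - coef b g.
Proof. by rewrite /coef !ffunE. Qed.

Lemma coef_act n (v : 'rV[ZGop G]_n) i h g :
  coef ((gact v h : 'rV[ZGop G]_n) 0 i) g = coef (v 0 i) (g * h^-1)%g.
Proof.
rewrite mxE /coef; change (((v 0 i : grpring G) * gelt h) g = v 0 i (g * h^-1)%g).
rewrite grmulE.
rewrite (bigD1 (g * h^-1)%g) //= big1 => [|k kh].
  by rewrite ffunE invMg invgK mulgKV eqxx mulr1 addr0.
rewrite ffunE; case: eqP => [e|]; last by rewrite mulr0.
by case/eqP: kh; rewrite -e invMg invgK mulKVg.
Qed.

Section DualFree.
Variable n : nat.
Implicit Types v w : 'rV[ZGop G]_n.

(** The standard inner product of Z[G]^n for which the elements of G times the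
    unit vectors are orthonormal.  It is G-invariant, hence identifies Z[G]^n
    with its dual. *)
Definition dot_fun v w : int := \sum_i \sum_g coef (w 0 i) g * coef (v 0 i) g.

Fact dot_funB v : {morph dot_fun v : w w' / w - w'}.
Proof.
move=> w w'; rewrite -sumrB; apply: eq_bigr => i _; rewrite -sumrB.
by apply: eq_bigr => g _; rewrite !mxE coefB mulrBl.
Qed.

Definition dot v : dual 'rV[ZGop G]_n := mk_dual (dot_funB v).

Fact dot_zmod : zmod_morphism dot.
Proof.
move=> v v'; apply: dualP => w.
rewrite -[RHS]/(dot_fun v w - dot_fun v' w) -[LHS]/(dot_fun (v - v') w).
rewrite -sumrB; apply: eq_bigr => i _; rewrite -sumrB.
by apply: eq_bigr => g _; rewrite !mxE coefB mulrBr.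
Qed.

HB.instance Definition _ :=
  GRing.isZmodMorphism.Build 'rV[ZGop G]_n (dual 'rV[ZGop G]_n) dot dot_zmod.

Fact dot_scalable : scalable dot.
Proof.
apply: equivariant_scalable => v h; apply: dualP => w.
rewrite dual_act -[LHS]/(dot_fun _ w) -[RHS]/(dot_fun v _).
apply: eq_bigr => i _; rewrite [LHS](reindex_inj (mulIg h)) /=.
by apply: eq_bigr => g _; rewrite !coef_act invgK mulgK.
Qed.

HB.instance Definition _ :=
  GRing.isScalable.Build (ZGop G) 'rV[ZGop G]_n (dual 'rV[ZGop G]_n) *:%R dot
    dot_scalable.

Let basis i g : 'rV[ZGop G]_n := gact (delta_mx 0 i : 'rV[ZGop G]_n) g.

Lemma dual_rV_expand (f : dual 'rV[ZGop G]_n) w :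
  f w = \sum_i \sum_g coef (w 0 i) g * f (basis i g).
Proof.
rewrite {1}[w]row_sum_delta raddf_sum; apply: eq_bigr => i _.
rewrite {1}[w 0 i](grp_sum (_ : grpring G)) scaler_suml raddf_sum.
apply: eq_bigr => g _; rewrite -scalerMzl raddfMz -mulrzl intz.
by congr (_ * _).
Qed.

Lemma dot_basis v i g : dot v (basis i g) = coef (v 0 i) g.
Proof.
rewrite -[LHS]/(dot_fun _ _) /dot_fun (bigD1 i) //= [X in _ + X]big1 => [|j ji].
  rewrite addr0 (bigD1 g) //= big1 => [|h hg].
    by rewrite coef_act !mxE !eqxx mulgV /coef ffunE eqxx mul1r addr0.
  rewrite coef_act !mxE !eqxx /coef ffunE -eq_mulgV1 (negPf hg) mul0r //.
by rewrite big1 // => h _; rewrite coef_act !mxE (negPf ji) /coef ffunE mul0r.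
Qed.

Lemma dual_rV : iso (dual 'rV[ZGop G]_n) 'rV[ZGop G]_n.
Proof.
apply: iso_sym; exists dot.
exists (fun f : dual 'rV[ZGop G]_n =>
  \row_i ([ffun g => f (basis i g)] : grpring G)) => [v|f].
  apply/rowP => i; rewrite mxE; apply/ffunP => g.
  by rewrite ffunE dot_basis.
apply: dualP => w; rewrite [RHS]dual_rV_expand -[LHS]/(dot_fun _ _).
by apply: eq_bigr => i _; apply: eq_bigr => g _; rewrite mxE /coef ffunE.
Qed.

End DualFree.

Lemma free_of_rank_dual M n : free_of_rank M n -> free_of_rank (dual M) n.
Proof. by move=> /iso_sym /iso_dual /iso_trans; apply; exact: dual_rV. Qed.

Lemma fgfree_dual M : fgfree M -> fgfree (dual M).
Proof. by move=> [n fM]; exists n; exact: free_of_rank_dual. Qed.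

End Free.

Section DualProd.
Variable G : finGroupType.
Implicit Types M N : rmod G.

Definition dual_prod M N : {linear (dual M * dual N)%type -> dual (M * N)%type} :=
  ladd (lin_comp (dual_map (lfst M N)) (lfst _ _))
    (lin_comp (dual_map (lsnd M N)) (lsnd _ _)).

Lemma dual_prodE M N (u : dual M) (v : dual N) z :
  dual_prod M N (u, v) z = u z.1 + v z.2.
Proof. by []. Qed.

Lemma dual_prod_bij M N : bijective (dual_prod M N).
Proof.
exists (lpair (dual_map (linl M N)) (dual_map (linr M N))) => [[u v]|w].
  by congr pair; apply: dualP => x; rewrite !dual_mapE dual_prodE /=
    dual0 (addr0, add0r).
apply: dualP => -[x y]; rewrite dual_prodE !dual_mapE -dualD /=.
by congr (dual_fun w _); congr pair; rewrite (addr0, add0r).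
Qed.

(** Naturality of evaluation: the double dual of f intertwines the evaluations of
    M and N. *)
Lemma ev_iso_bij M N : iso M N -> bijective (ev N) -> bijective (ev M).
Proof.
move=> [f fb] evb.
have evf x : dual_map (dual_map f) (ev M x) = ev N (f x) by exact: dualP.
exists (fun w => lin_inv fb (lin_inv evb (dual_map (dual_map f) w))) => [x|w].
  by rewrite evf /= !lin_invK.
have injff : injective (dual_map (dual_map f)).
  move=> w1 w2 e; apply: dualP => u.
  have -> : u = dual_map f (dual_map (lin_inv fb) u).
    by apply: dualP => x; rewrite !dual_mapE /= lin_invK.
  exact: (congr1 (fun v : dual (dual N) => v (dual_map (lin_inv fb) u)) e).
by apply: injff; rewrite evf /= !lin_invKV.
Qed.

(** A free module is the kernel of its zero endomorphism, and evaluation is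
    bijective on kernels. *)
Lemma ev_free_bij M : fgfree M -> bijective (ev M).
Proof.
move=> fM; pose z := lzero M M; apply: (@ev_iso_bij _ (ker z)); last first.
  exact: ev_ker_bij.
have [//|i iP] := @ker_factor _ _ _ _ z (idfun : {linear M -> M}).
exists i; exists (ker_incl z) => x; first exact: iP.
by apply: val_inj; exact: iP.
Qed.

End DualProd.

(** * Schanuel's lemma *)

Section Schanuel.
Variable G : finGroupType.

Lemma fgfree_lift (X Y M : rmod G) (p : {linear X -> M}) (q : {linear Y -> M}) :
  fgfree X -> (forall x, exists y, q y = p x) ->
  exists u : {linear X -> Y}, forall x, q (u x) = p x.
Proof.
move=> [n [c cb]] pq.
have [l lP] := choice (fun i : 'I_n => pq (lin_inv cb (delta_mx 0 i))).
have uL : linear (fun v : 'rV[ZGop G]_n => \sum_i v 0 i *: l i).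
  move=> a v w; rewrite scaler_sumr -big_split; apply: eq_bigr => i _.
  by rewrite !mxE scalerDl scalerA.
exists (lin_comp (mklin uL) c) => x /=; rewrite raddf_sum.
transitivity (p (lin_inv cb (c x))); last by rewrite /= lin_invK.
rewrite {2}[c x]row_sum_delta !raddf_sum; apply: eq_bigr => i _.
by rewrite [LHS]linearZ_LR lP -linearZ_LR; congr (p _); rewrite -linearZ_LR.
Qed.

(** The isomorphism is a product of two shears followed by the swap: with lifts
    u of p through q and v of q through p, the first shear carries (p, 0) to
    (p, q), and the second carries (p, q) to (0, q). *)
Lemma schanuel (X Y M : rmod G) (p : {linear X -> M}) (q : {linear Y -> M}) :
    fgfree X -> fgfree Y ->
    (forall x, exists y, q y = p x) -> (forall y, exists x, p x = q y) ->
  exists2 t : {linear (X * Y)%type -> (Y * X)%type}, bijective t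
    & forall z, q (t z).1 = p z.1.
Proof.
move=> fX fY /(fgfree_lift fX)[u uP] /(fgfree_lift fY)[v vP].
pose w : {linear (X * Y)%type -> X} :=
  lsub (lfst _ _) (lin_comp v (lsnd _ _)).
exists (lpair (ladd (lsnd _ _) (lin_comp u w)) w) => [|[x y] /=]; last first.
  by rewrite linearD uP linearB vP addrC subrK.
exists (fun z => (z.2 + v (z.1 - u z.2), z.1 - u z.2)) => -[x y] /=.
  by rewrite addrK subrK.
by rewrite addrK subrK.
Qed.

(** Two exact rows X' -> X -> M and Y' -> Y -> M over Schanuel-equivalent maps
    X -> M and Y -> M become X' + Y -> X + Y and Y' + X -> Y + X.  By exactness
    their images are the kernels of (p, 0) and (q, 0), which t identifies.  So
    Schanuel's lemma applies one degree further up. *)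
Lemma schanuel_step (X Y M X' Y' : rmod G)
    (p : {linear X -> M}) (q : {linear Y -> M})
    (pX : {linear X' -> X}) (qY : {linear Y' -> Y})
    (t : {linear (X * Y)%type -> (Y * X)%type}) :
    fgfree X -> fgfree Y -> fgfree X' -> fgfree Y' ->
    exact pX p -> exact qY q -> bijective t ->
    (forall z, q (t z).1 = p z.1) ->
  exists2 t' : {linear ((X' * Y) * (Y' * X))%type -> ((Y' * X) * (X' * Y))%type},
    bijective t' & forall z, lprod qY idfun (t' z).1 = t (lprod pX idfun z.1).
Proof.
move=> fX fY fX' fY' exX exY tb tP; have [t1 tK t1K] := tb.
apply: (schanuel (p := lin_comp t (lprod pX idfun)) (q := lprod qY idfun)).
- exact: fgfree_prod.
- exact: fgfree_prod.
- move=> [x' y]; set z := (pX x', y).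
  have [|y' y'P] := (exY (t z).1).1.
    by rewrite tP /=; apply/exX; exists x'.
  by exists (y', (t z).2); rewrite /= y'P -surjective_pairing.
- move=> [y' x]; set z := t1 (qY y', x).
  have [|x' x'P] := (exX z.1).1.
    by rewrite -tP t1K /=; apply/exY; exists y'.
  by exists (x', z.2); rewrite /= x'P -surjective_pairing t1K.
Qed.

End Schanuel.

(** * The Euler characteristic *)

Section Rank.
Variable G : finGroupType.
Implicit Types (M N : rmod G) (C D : complex5 G).

(** The trace of h tensored with Z over Z[G], in the basis given by c.  Working
    over Z rather than Z[G] makes the trace an integer and the ring commutative,
    which [ltrace_comp] needs. *)
Definition ltrace M n (c : {linear M -> 'rV[ZGop G]_n}) (cb : bijective c)
    (h : {linear M -> M}) : int :=
  \sum_i augm (c (h (lin_inv cb (delta_mx 0 i))) 0 i).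

Lemma augm0 : augm (0 : grpring G) = 0.
Proof. by apply: (addIr (augm (0 : grpring G))); rewrite -augmD !add0r. Qed.

Lemma augmZ n (a : ZGop G) (v : 'rV[ZGop G]_n) i :
  augm ((a *: v) 0 i) = augm a * augm (v 0 i).
Proof. by rewrite mxE mulrC; exact: augmM. Qed.

(** Matrix multiplication, after augmentation of the entries. *)
Lemma augm_coord M N m n (c : {linear M -> 'rV[ZGop G]_m})
    (e : {linear N -> 'rV[ZGop G]_n}) (eb : bijective e)
    (g : {linear N -> M}) y i :
  augm (c (g y) 0 i) =
  \sum_j augm (e y 0 j) * augm (c (g (lin_inv eb (delta_mx 0 j))) 0 i).
Proof.
have {1}-> : y = \sum_j e y 0 j *: lin_inv eb (delta_mx 0 j).
  apply: (bij_inj eb); rewrite raddf_sum {1}[e y]row_sum_delta.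
  by apply: eq_bigr => j _; rewrite [RHS]linearZ_LR /= lin_invKV.
rewrite !raddf_sum summxE.
rewrite (big_morph (@augm G) (@augmD G) augm0).
by apply: eq_bigr => j _; rewrite -augmZ -!linearZ_LR.
Qed.

Lemma ltrace_comp M N m n (c : {linear M -> 'rV[ZGop G]_m}) (cb : bijective c)
    (e : {linear N -> 'rV[ZGop G]_n}) (eb : bijective e)
    (f : {linear M -> N}) (g : {linear N -> M}) :
  ltrace cb (lin_comp g f) = ltrace eb (lin_comp f g).
Proof.
rewrite /ltrace.
under eq_bigr => i _ do rewrite (augm_coord c eb g).
under [RHS]eq_bigr => i _ do rewrite (augm_coord e cb f).
rewrite exchange_big; apply: eq_bigr => j _; apply: eq_bigr => i _.
by rewrite mulrC.
Qed.

Lemma ltraceD M n (c : {linear M -> 'rV[ZGop G]_n}) (cb : bijective c)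
    (f g : {linear M -> M}) :
  ltrace cb (ladd f g) = ltrace cb f + ltrace cb g.
Proof.
rewrite /ltrace -big_split; apply: eq_bigr => i _.
by rewrite /= linearD mxE augmD.
Qed.

Lemma ltrace_id M n (c : {linear M -> 'rV[ZGop G]_n}) (cb : bijective c) :
  ltrace cb idfun = n%:Z.
Proof.
rewrite -natz -[n in RHS]card_ord -sumr_const; apply: eq_bigr => i _ /=.
by rewrite lin_invKV mxE !eqxx; exact: (augm_gelt 1%g).
Qed.

Lemma eq_ltrace M n (c : {linear M -> 'rV[ZGop G]_n}) (cb : bijective c)
    (f g : {linear M -> M}) : f =1 g -> ltrace cb f = ltrace cb g.
Proof. by move=> fg; apply: eq_bigr => i _; rewrite fg. Qed.

(** Hopf's trace formula: if f - 1 = d s + s d, the traces of d s in degree i and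
    of s d in degree i + 1 agree and cancel in the alternating sum, leaving the
    alternating sum of the traces of the identities. *)
Lemma ltrace_homotopy C (f : chain_map C C) n5 n4 n3 n2 n1 n0
    (c5 : {linear cx5 C -> 'rV[ZGop G]_n5}) (b5 : bijective c5)
    (c4 : {linear cx4 C -> 'rV[ZGop G]_n4}) (b4 : bijective c4)
    (c3 : {linear cx3 C -> 'rV[ZGop G]_n3}) (b3 : bijective c3)
    (c2 : {linear cx2 C -> 'rV[ZGop G]_n2}) (b2 : bijective c2)
    (c1 : {linear cx1 C -> 'rV[ZGop G]_n1}) (b1 : bijective c1)
    (c0 : {linear cx0 C -> 'rV[ZGop G]_n0}) (b0 : bijective c0) :
  homotopic f (cm_id C) ->
  ltrace b0 (cm0 f) - ltrace b1 (cm1 f) + ltrace b2 (cm2 f)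
    - ltrace b3 (cm3 f) + ltrace b4 (cm4 f) - ltrace b5 (cm5 f)
  = (n0%:Z + n2%:Z + n4%:Z) - (n1%:Z + n3%:Z + n5%:Z).
Proof.
move=> [h].
have e0 : ltrace b0 (cm0 f) = ltrace b0 (lin_comp (bd1 C) (ch0 h)) + n0%:Z.
  rewrite -(ltrace_id b0) -ltraceD; apply: eq_ltrace => x /=.
  by rewrite -(ch_0 h) subrK.
have e1 : ltrace b1 (cm1 f) = ltrace b1 (lin_comp (bd2 C) (ch1 h))
    + ltrace b0 (lin_comp (bd1 C) (ch0 h)) + n1%:Z.
  rewrite (ltrace_comp b0 b1) -(ltrace_id b1) -!ltraceD; apply: eq_ltrace => x /=.
  by rewrite -(ch_1 h) subrK.
have e2 : ltrace b2 (cm2 f) = ltrace b2 (lin_comp (bd3 C) (ch2 h))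
    + ltrace b1 (lin_comp (bd2 C) (ch1 h)) + n2%:Z.
  rewrite (ltrace_comp b1 b2) -(ltrace_id b2) -!ltraceD; apply: eq_ltrace => x /=.
  by rewrite -(ch_2 h) subrK.
have e3 : ltrace b3 (cm3 f) = ltrace b3 (lin_comp (bd4 C) (ch3 h))
    + ltrace b2 (lin_comp (bd3 C) (ch2 h)) + n3%:Z.
  rewrite (ltrace_comp b2 b3) -(ltrace_id b3) -!ltraceD; apply: eq_ltrace => x /=.
  by rewrite -(ch_3 h) subrK.
have e4 : ltrace b4 (cm4 f) = ltrace b4 (lin_comp (bd5 C) (ch4 h))
    + ltrace b3 (lin_comp (bd4 C) (ch3 h)) + n4%:Z.
  rewrite (ltrace_comp b3 b4) -(ltrace_id b4) -!ltraceD; apply: eq_ltrace => x /=.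
  by rewrite -(ch_4 h) subrK.
have e5 : ltrace b5 (cm5 f) = ltrace b4 (lin_comp (bd5 C) (ch4 h)) + n5%:Z.
  rewrite (ltrace_comp b4 b5) -(ltrace_id b5) -!ltraceD; apply: eq_ltrace => x /=.
  by rewrite -(ch_5 h) subrK.
rewrite {}e0 {}e1 {}e2 {}e3 {}e4 {}e5; lia.
Qed.

(** The two composites g f and f g have the same traces, and both are homotopic
    to the identity. *)
Lemma euler_char_equiv C D n5 n4 n3 n2 n1 n0 m5 m4 m3 m2 m1 m0 :
    free_of_rank (cx5 C) n5 -> free_of_rank (cx4 C) n4 ->
    free_of_rank (cx3 C) n3 -> free_of_rank (cx2 C) n2 ->
    free_of_rank (cx1 C) n1 -> free_of_rank (cx0 C) n0 ->
    free_of_rank (cx5 D) m5 -> free_of_rank (cx4 D) m4 ->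
    free_of_rank (cx3 D) m3 -> free_of_rank (cx2 D) m2 ->
    free_of_rank (cx1 D) m1 -> free_of_rank (cx0 D) m0 ->
    chain_equiv C D ->
  (n0%:Z + n2%:Z + n4%:Z) - (n1%:Z + n3%:Z + n5%:Z) =
  (m0%:Z + m2%:Z + m4%:Z) - (m1%:Z + m3%:Z + m5%:Z).
Proof.
move=> [c5 b5] [c4 b4] [c3 b3] [c2 b2] [c1 b1] [c0 b0].
move=> [c5' b5'] [c4' b4'] [c3' b3'] [c2' b2'] [c1' b1'] [c0' b0'].
move=> [f [g [gf fg]]].
rewrite -(ltrace_homotopy b5 b4 b3 b2 b1 b0 gf).
rewrite -(ltrace_homotopy b5' b4' b3' b2' b1' b0' fg) /=.
rewrite (ltrace_comp b5 b5') (ltrace_comp b4 b4') (ltrace_comp b3 b3').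
by rewrite (ltrace_comp b2 b2') (ltrace_comp b1 b1') (ltrace_comp b0 b0').
Qed.

End Rank.

(** * Homotopy invariance of homology *)

Section Invariance.
Variable G : finGroupType.
Implicit Types (M N : rmod G) (C D : complex5 G).

Fact coker_pi_linear M N (d : {linear M -> N}) : linear (coker_pi d).
Proof. by move=> a x y; rewrite -coker_piD -coker_piZ. Qed.

Definition coker_proj M N (d : {linear M -> N}) : {linear N -> coker d} :=
  mklin (@coker_pi_linear M N d).

Lemma coker_proj_exact M N (d : {linear M -> N}) : exact d (coker_proj d).
Proof.
move=> y; split=> [|[x <-]].
  move=> /(coker_eqP d y 0).1[x xP].
  by exists x; rewrite -xP subr0.
by apply/(coker_eqP d (d x) 0).2; exists x; rewrite subr0.
Qed.

Lemma coker_proj_surj M N (d : {linear M -> N}) u : exists y, coker_proj d y = u.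
Proof. by exists (repr u); exact: coker_piK. Qed.

Lemma coker_equiv C D : chain_equiv C D -> iso (coker (bd1 C)) (coker (bd1 D)).
Proof.
have cokM (E F : complex5 G) (f : chain_map E F) :
    exists h : {linear coker (bd1 E) -> coker (bd1 F)},
    forall x, h (coker_proj (bd1 E) x) = coker_proj (bd1 F) (cm0 f x).
  apply: (@lin_factor _ _ _ _ _ (lin_comp (coker_proj (bd1 F)) (cm0 f))).
    exact: coker_proj_surj.
  move=> x /coker_proj_exact[y <-] /=; apply/coker_proj_exact.
  by exists (cm1 f y); rewrite cm_bd1.
have cokI (E F : complex5 G) (f : chain_map E F) (g : chain_map F E) x :
    homotopic (cm_comp g f) (cm_id E) ->
  coker_proj (bd1 E) (cm0 g (cm0 f x)) = coker_proj (bd1 E) x.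
  move=> [h]; apply/eqP; rewrite -subr_eq0 -linearB; apply/eqP.
  by apply/coker_proj_exact; exists (ch0 h x); rewrite -(ch_0 h).
move=> [f [g [gf fg]]].
have [h hP] := cokM _ _ f; have [k kP] := cokM _ _ g.
exists h; exists k => u; have [x <-] := coker_proj_surj u.
  by rewrite hP kP cokI.
by rewrite kP hP cokI.
Qed.

Lemma ker_equiv C D : chain_equiv C D -> iso (ker (bd5 C)) (ker (bd5 D)).
Proof.
have kerM (E F : complex5 G) (f : chain_map E F) :
    exists h : {linear ker (bd5 E) -> ker (bd5 F)},
    forall x, ker_incl _ (h x) = cm5 f (ker_incl _ x).
  apply: (@ker_factor _ _ _ _ _ (lin_comp (cm5 f) (ker_incl _))) => x /=.
  by rewrite -cm_bd5 ker_inclP linear0.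
have kerI (E F : complex5 G) (f : chain_map E F) (g : chain_map F E) x :
    homotopic (cm_comp g f) (cm_id E) -> bd5 E x = 0 ->
  cm5 g (cm5 f x) = x.
  move=> [h] dx; apply/eqP; rewrite -subr_eq0; apply/eqP.
  by have := ch_5 h x; rewrite dx linear0.
move=> [f [g [gf fg]]].
have [h hP] := kerM _ _ f; have [k kP] := kerM _ _ g.
exists h; exists k => x; apply: val_inj.
  by rewrite -[LHS]/(ker_incl _ _) kP hP kerI // ker_inclP.
by rewrite -[LHS]/(ker_incl _ _) hP kP kerI // ker_inclP.
Qed.

Lemma exact4_equiv C D :
  chain_equiv C D -> exact (bd5 C) (bd4 C) -> exact (bd5 D) (bd4 D).
Proof.
move=> [f [g [_ [h]]]] exC y; split=> [dy|[x <-]]; last exact: bd45.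
have [|x xP] := (exC (cm4 g y)).1; first by rewrite -cm_bd4 dy linear0.
exists (cm5 f x - ch4 h y); rewrite linearB -cm_bd5 xP.
by have := ch_4 h y; rewrite /= dy linear0 addr0 => <-; rewrite subKr.
Qed.

Lemma exact1_equiv C D :
  chain_equiv C D -> exact (bd2 C) (bd1 C) -> exact (bd2 D) (bd1 D).
Proof.
move=> [f [g [_ [h]]]] exC y; split=> [dy|[x <-]]; last exact: bd12.
have [|x xP] := (exC (cm1 g y)).1; first by rewrite -cm_bd1 dy linear0.
exists (cm2 f x - ch1 h y); rewrite linearB -cm_bd2 xP.
by have := ch_1 h y; rewrite /= dy linear0 addr0 => <-; rewrite subKr.
Qed.

End Invariance.

(** * Complexes in dual form *)

Section Forms.
Variables (G : finGroupType) (F : half_complex G).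

(** The kernel of d2 is a direct summand over Z, so functionals extend from it. *)
Lemma iota_dual_surj (f : hcJ F) : exists u, iota_dual F u = f.
Proof.
have [p pK] := ker_retract (hd2 F) (hc_free2 F) (hc_free1 F).
have fpB : {morph (fun x => f (p x)) : x y / x - y} by move=> x y; rewrite !raddfB.
exists (mk_dual fpB); apply: dualP => x.
by rewrite -[LHS]/(f (p (ker_incl _ x))) pK.
Qed.

(** A functional vanishing on ker d2 descends to the image of d2, which is ker d1
    by exactness and hence a direct summand over Z; so the descended functional
    extends to all of F1. *)
Lemma iota_dual_ker (u : dual (hc2 F)) :
  iota_dual F u = 0 -> exists v, dual_map (hd2 F) v = u.
Proof.
move=> u0; have uK x y : hd2 F x = hd2 F y -> u x = u y.
  move=> e; have dxy : kerp (hd2 F) (x - y).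
    by apply/eqP; rewrite linearB e subrr.
  apply/eqP; rewrite -subr_eq0 -raddfB.
  have -> : x - y = ker_incl (hd2 F) (exist (fun z => kerp (hd2 F) z) _ dxy) by [].
  by rewrite -dual_mapE -[dual_map _ u]/(iota_dual F u) u0.
have [p pK] := ker_retract (hd1 F) (hc_free1 F) (hc_free0 F).
have sP (z : hc1 F) : exists x, hd2 F x = ker_incl _ (p z).
  by apply/hc_exact1; exact: ker_inclP.
have [s sK] := choice sP.
have vB : {morph (fun z => u (s z)) : x y / x - y}.
  by move=> x y; rewrite -raddfB; apply: uK; rewrite linearB !sK !raddfB.
exists (mk_dual vB); apply: dualP => x; rewrite -[LHS]/(u (s (hd2 F x))).
apply: uK; rewrite sK.
have dx : kerp (hd1 F) (hd2 F x) by apply/eqP; exact: hd12.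
by rewrite -[hd2 F x]/(ker_incl (hd1 F) (exist (fun z => kerp _ z) _ dx)) pK.
Qed.

Lemma form_of_map (J : rmod G) (h : {linear J -> dual J}) :
  exists b : invform J, form_map b =1 h.
Proof.
unshelve eexists; first apply: (@InvForm G J (fun x y => h x y)).
- by move=> x y z; rewrite linearD dualDE.
- by move=> x y z; rewrite dualD.
- move=> x y g; have -> : h (gact x g) = gact (h x) g by exact: linearZ_LR.
  by rewrite dual_act gactM mulgV gact1.
by move=> x; apply: dualP.
Qed.

(** By the two preceding lemmas iota^* is a cokernel of d2^*, and iota is a kernel
    of d2; so m factors through both. *)
Lemma mid_map_onto (m : {linear dual (hc2 F) -> hc2 F}) :
    (forall u, hd2 F (m u) = 0) -> (forall v, m (dual_map (hd2 F) v) = 0) ->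
  exists b : invform (hcJ F), mid_map b =1 m.
Proof.
move=> dm md.
have [m' m'P] := ker_factor dm.
have [|u /iota_dual_ker[v <-]|h hP] := @lin_factor _ _ _ _ (iota_dual F) m'.
- exact: iota_dual_surj.
- by apply: val_inj; rewrite -[LHS]/(ker_incl _ _) m'P md.
have [b bP] := form_of_map (lin_comp (ev _) h).
exists b => u; rewrite -m'P -hP /mid_map /= bP /=.
exact: bidual_incl_ev.
Qed.

(** Reading d3 through k3 gives a map from the dual of F2 to F2; it kills the image
    of d2^* because d3 d4 = 0, and so it comes from a form. *)
Lemma dual_form_equiv (X5 X4 X3 : rmod G) (d5 : {linear X5 -> X4})
    (d4 : {linear X4 -> X3}) (d3 : {linear X3 -> hc2 F})
    (k5 : {linear X5 -> dual (hc0 F)}) (k4 : {linear X4 -> dual (hc1 F)})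
    (k3 : {linear X3 -> dual (hc2 F)}) d45 d34 d23 :
    bijective k5 -> bijective k4 -> bijective k3 ->
    (forall x, k4 (d5 x) = dual_map (hd1 F) (k5 x)) ->
    (forall x, k3 (d4 x) = dual_map (hd2 F) (k4 x)) ->
  exists b : invform (hcJ F),
    chain_equiv (@Complex5 G _ _ _ _ _ _ d5 d4 d3 (hd2 F) (hd1 F)
      d45 d34 d23 (@hd12 G F)) (associated b).
Proof.
move=> k5b k4b k3b k45 k34.
pose m : {linear dual (hc2 F) -> hc2 F} := lin_comp d3 (lin_inv k3b).
have mK x : m (k3 x) = d3 x by rewrite /m /= lin_invK.
have [u|v|b bP] := @mid_map_onto m; first exact: d23.
  have [k4' _ k4K] := k4b.
  by rewrite -[v]k4K -k34 mK; exact: d34.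
exists b; set X := Complex5 _ _ _ _.
unshelve eapply chain_iso_equiv.
  apply: (@ChainMap G X (associated b) k5 k4 k3 idfun idfun idfun) => // x.
  by rewrite -mK -bP.
- exact: k5b.
- exact: k4b.
- exact: k3b.
- by exists id.
- by exists id.
- by exists id.
Qed.

End Forms.

Lemma alg5_associated (G : finGroupType) (C : ALG5 G) (F : half_complex G)
    (b : invform (hcJ F)) :
  chain_equiv C (associated b) -> exists D : ALG5 G, alg_cx D = associated b.
Proof.
move=> CA.
have dualA : chain_equiv (associated b) (dual_complex (associated b)).
  apply: (chain_equiv_trans (chain_equiv_sym CA)).
  exact: (chain_equiv_trans (alg_duality C) (chain_equiv_dual CA)).
by exists (@Alg5 G (associated b) (fgfree_dual (hc_free0 F))
  (fgfree_dual (hc_free1 F)) (fgfree_dual (hc_free2 F))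
  (hc_free2 F) (hc_free1 F) (hc_free0 F) dualA
  (exact4_equiv CA (@alg_exact4 G C)) (@hc_exact1 G F) (hc_coker F)
  (iso_trans (iso_sym (ker_equiv CA)) (alg_ker C))).
Qed.

(** * Replacing the lower half *)

Section Replace.
Variables (G : finGroupType) (C : complex5 G) (Z B2 B1 B0 : rmod G).
Variables (dB2 : {linear B2 -> B1}) (dB1 : {linear B1 -> B0}).
Variables (eA : {linear cx0 C -> Z}) (eB : {linear B0 -> Z}).
Hypotheses (freeA2 : fgfree (cx2 C)) (freeA1 : fgfree (cx1 C))
  (freeA0 : fgfree (cx0 C)).
Hypotheses (freeB2 : fgfree B2) (freeB1 : fgfree B1) (freeB0 : fgfree B0).
Hypotheses (exA1 : exact (bd2 C) (bd1 C)) (exA0 : exact (bd1 C) eA).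
Hypotheses (exB1 : exact dB2 dB1) (exB0 : exact dB1 eB).
Hypotheses (eA_surj : forall z, exists x, eA x = z)
  (eB_surj : forall z, exists x, eB x = z).

Local Notation X1 := (cx1 C * B0)%type.
Local Notation Y1 := (B1 * cx0 C)%type.
Local Notation X2 := (cx2 C * Y1)%type.
Local Notation Y2 := (B2 * X1)%type.

(** Adding B0, Y1 and Y2 to C, and A0 = cx0 C and X1 to the new complex, gives isomorphic
    complexes: the isomorphisms in degrees 0, 1 and 2 come from Schanuel's lemma,
    and the new d3 is the old one followed by the isomorphism in degree 2. *)
Lemma replace_lower :
  exists (d3 : {linear (cx3 C * Y2)%type -> (B2 * X2)%type})
    d45 d34 d23 d12,
  chain_equiv C (@Complex5 G (cx5 C) (cx4 C) (cx3 C * Y2)%type (B2 * X2)%type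
     B1 B0 (bd5 C) (lin_comp (linl _ Y2) (bd4 C)) d3
     (lin_comp dB2 (lfst _ X2)) dB1 d45 d34 d23 d12).
Proof.
have [t0 b0 t0P] : exists2 t : {linear (cx0 C * B0)%type -> (B0 * cx0 C)%type},
    bijective t & forall z, eB (t z).1 = eA z.1.
  by apply: schanuel.
have [t1 b1 t1P] := schanuel_step freeA0 freeB0 freeA1 freeB1 exA0 exB0 b0 t0P.
(* The hypotheses of the last step: both rows are exact in degree 1. *)
have exX : exact (lin_comp (linl _ B0) (bd2 C)) (lin_comp t0 (lprod (bd1 C) idfun)).
  move=> [x y]; split=> [/= e|[z [<- <-]] /=]; last first.
    by rewrite bd12 -[(0, 0)]/(0 : (_ * _)%type) linear0.
  have [dx y0] : (bd1 C x, y) = (0, 0).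
    by apply: (bij_inj b0); rewrite e -[(0, 0)]/(0 : (_ * _)%type) linear0.
  by have [z <-] := (exA1 x).1 dx; exists z; rewrite /= y0.
have exY : exact (lin_comp (linl _ (cx0 C)) dB2) (lprod dB1 idfun).
  move=> [x y]; split=> [/= [dx ->]|[z [<- <-]] /=]; last first.
    by congr pair; apply/exB1; exists z.
  by have [z <-] := (exB1 x).1 dx; exists z.
have [t2 b2 t2P] := schanuel_step (fgfree_prod freeA1 freeB0)
  (fgfree_prod freeB1 freeA0) freeA2 freeB2 exX exY b1 t1P.
pose K := expand_mid (expand_low C B0 Y1) Y2.
pose rho : {linear (Y2 * X2)%type -> ((B2 * X2) * X1)%type} :=
  lpair (lpair (lin_comp (lfst B2 X1) (lfst Y2 X2)) (lsnd Y2 X2))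
    (lin_comp (lsnd B2 X1) (lfst Y2 X2)).
pose r : {linear cx3 K -> ((B2 * X2) * X1)%type} :=
  lin_comp rho (lin_comp t2 (bd3 K)).
have qr x : lprod (lin_comp (linl _ (cx0 C)) dB2) idfun (t2 (bd3 K x)).1 = 0.
  by rewrite t2P -[lprod _ _ (bd3 K x).1]/(bd2 K (bd3 K x)) bd23 linear0.
(* The X1 component of r vanishes because the differential to degree 1 is the
   identity on it; so r is d3 followed by the inclusion of the first summand. *)
have rE x : r x = ((r x).1, 0).
  by rewrite [LHS]surjective_pairing; congr pair; exact: (congr1 snd (qr x)).
pose d3 : {linear (cx3 C * Y2)%type -> (B2 * X2)%type} := lin_comp (lfst _ X1) r.
have d45 x : lin_comp (linl _ Y2) (bd4 C) (bd5 C x) = 0 by exact: (@bd45 G K).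
have d34 x : d3 (lin_comp (linl _ Y2) (bd4 C) x) = 0.
  rewrite -[LHS]/(rho (t2 (bd3 K (bd4 K x)))).1.
  by rewrite bd34 !linear0.
have d23 x : lin_comp dB2 (lfst _ X2) (d3 x) = 0.
  exact: (congr1 (fun z => z.1.1) (qr x)).
have d12 x : dB1 (lin_comp dB2 (lfst B2 X2) x) = 0.
  by apply/exB1; exists x.1.
exists d3, d45, d34, d23, d12; set D := Complex5 _ _ _ _.
apply: (chain_equiv_trans (expand_low_equiv C B0 Y1)).
apply: (chain_equiv_trans (expand_mid_equiv _ Y2)).
apply: chain_equiv_trans (chain_equiv_sym (expand_low_equiv D (cx0 C) X1)).
unshelve eapply chain_iso_equiv.
  apply: (@ChainMap G K (expand_low D (cx0 C) X1) idfun idfun idfun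
    (lin_comp rho t2) t1 t0) => // x.
- by rewrite -[LHS]/(t1 (lprod _ _ x.1)) -t2P.
- by rewrite -[LHS]/(t0 (lprod _ _ x.1)) -t1P.
- by exists id.
- by exists id.
- by exists id.
- apply: bij_comp b2.
  by exists (fun z => ((z.1.1, z.2), z.1.2)) => [[[? ?] ?]|[[? ?] ?]].
- exact: b1.
- exact: b0.
Qed.

End Replace.

(** * Assembling the dual form *)

Theorem theorem4p2p1 (G : finGroupType) (C : ALG5 G) :
  exists D : ALG5 G, in_dual_form D /\ chain_equiv C D.
Proof.
have [n5 f5] := alg_free5 C; have [n4 f4] := alg_free4 C.
have [n3 f3] := alg_free3 C; have [n2 f2] := alg_free2 C.
have [n1 f1] := alg_free1 C; have [n0 f0] := alg_free0 C.
have f5' := free_of_rank_dual f5; have f4' := free_of_rank_dual f4.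
have f3' := free_of_rank_dual f3; have f2' := free_of_rank_dual f2.
have f1' := free_of_rank_dual f1; have f0' := free_of_rank_dual f0.
have chi := @euler_char_equiv G C (dual_complex C) _ _ _ _ _ _ _ _ _ _ _ _
  f5 f4 f3 f2 f1 f0 f0' f1' f2' f3' f4' f5' (alg_duality C).
pose dB2 := bd2 (dual_complex C); pose dB1 := bd1 (dual_complex C).
have exB : exact dB2 dB1 := exact1_equiv (alg_duality C) (@alg_exact1 G C).
have [h hb] := coker_equiv (alg_duality C); have h_inj := bij_inj hb.
(* Both halves are augmented to the cokernel of the dual complex. *)
pose eA := lin_comp h (coker_proj (bd1 C)).
have exA : exact (bd1 C) eA.
  move=> x; split=> [/= e|/coker_proj_exact /= ->]; last exact: linear0.
  by apply/coker_proj_exact/h_inj; rewrite e linear0.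
have eA_surj z : exists x, eA x = z.
  have [k _ hK] := hb; have [x xP] := coker_proj_surj (k z).
  by exists x; rewrite -[LHS]/(h (coker_proj _ x)) xP.
have [d3 [d45 [d34 [d23 [d12 CD]]]]] := @replace_lower G C _ _ _ _
  dB2 dB1 eA (coker_proj dB1)
  (alg_free2 C) (alg_free1 C) (alg_free0 C)
  (fgfree_dual (alg_free3 C)) (fgfree_dual (alg_free4 C))
  (fgfree_dual (alg_free5 C))
  (@alg_exact1 G C) exA exB (@coker_proj_exact _ _ _ _) eA_surj
  (@coker_proj_surj _ _ _ _).
set B2 := cx2 (dual_complex C) in d3 d45 d34 d23 d12 CD.
set Y2 := (B2 * _)%type in d3 d45 d34 d23 d12 CD.
set X2 := (cx2 C * _)%type in d3 d45 d34 d23 d12 CD.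
have fY2 : free_of_rank Y2 (n3 + (n1 + n5)).
  by do 2![apply: free_of_rank_prod => //].
have fX2 : free_of_rank X2 (n2 + (n4 + n0)).
  by do 2![apply: free_of_rank_prod => //].
have [j jb] : iso Y2 (dual X2).
  apply: iso_trans fY2 (iso_sym _).
  (* The Euler characteristic equals its own negative, hence vanishes. *)
  suff -> : (n3 + (n1 + n5) = n2 + (n4 + n0))%N by exact: free_of_rank_dual.
  lia.
have exE : exact (lin_comp dB2 (lfst B2 X2)) dB1.
  move=> y; split=> [/exB[b <-]|[x <-]]; last exact: d12.
  by exists (b, 0).
have cokE : iso (coker dB1) (trivZ G).
  by apply: iso_trans (alg_coker C); apply: iso_sym; exists h.
have fE2 : fgfree (B2 * X2)%type.
  by apply: fgfree_prod; [exists n3 | exists (n2 + (n4 + n0))%N].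
pose E : half_complex G := @HalfComplex G (B2 * X2)%type _ _ _ _ d12 fE2
  (fgfree_dual (alg_free4 C)) (fgfree_dual (alg_free5 C)) exE cokE.
(* On F3 the identification with the dual of B2 = F3^* is evaluation; on Y2 any
   isomorphism with the dual of X2 will do, as d4 has no component there. *)
pose k3 := lin_comp (dual_prod _ _) (lprod (ev (cx3 C)) j).
have k3b : bijective k3.
  apply: bij_comp; first exact: dual_prod_bij.
  by apply: lprod_bij => //; exact: ev_free_bij (alg_free3 C).
have [||x|x|b XA] := @dual_form_equiv G E _ _ _
  (bd5 C) (lin_comp (linl _ Y2) (bd4 C)) d3 (ev _) (ev _) k3 d45 d34 d23 _ _ k3b.
- exact: ev_free_bij (alg_free5 C).
- exact: ev_free_bij (alg_free4 C).
- exact: dualP.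
- apply: dualP => -[b z].
  by rewrite /k3 /= linear0; exact: addr0.
have CA := chain_equiv_trans CD XA.
have [D DE] := alg5_associated CA.
by exists D; split; [exists E, b | rewrite DE].
Qed.
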